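(* Let $\beta_0>0$ be a constant such that for all sufficiently large $X$ there is at least one prime between $X$ and $X+X^{\beta_0}$, let $\beta\in(\beta_0,1)$, let $c>0$, and let $(p_n)_n$ be an infinite strictly increasing sequence of primes with $p_{n+1}\le p_n+p_n^{\beta}$ for all $n$, such that for every $n$ every Cayley graph of $\mathrm{SL}(2,p_n)$ (with respect to any symmetric generating set) is a $c$-expander. Let $k\ge 4$. Then the family of product replacement graphs $\{\Gamma_k(\mathrm{SL}(2,p_n))\}_n$ forms a family of expanders, i.e. there is $c'>0$ such that $c(\Gamma_k(\mathrm{SL}(2,p_n)))\ge c'$ for all $n$.
   Context: Here $\mathrm{SL}(2,p)=\mathrm{SL}_2(\mathbb{F}_p)$. For a finite group $G$ and a symmetric set $S\subset G$ generating $G$, the Cayley graph $\mathcal{G}(G,S)$ has vertex set $G$ and an edge from $x$ to $y$ if and only if $x=\sigma y$ for some $\sigma\in S$. For a finite graph $\mathcal{G}$ (loops and multiple edges allowed) and a nonempty set $Y$ of vertices, let $\partial(Y)$ be the set of vertices at graph distance exactly $1$ from $Y$, and let $c(Y)=|\partial(Y)|/|Y|$. The expansion coefficient is $c(\mathcal{G})=\inf\{c(Y): Y\neq\emptyset,\ |Y|<\frac12|\mathcal{G}|\}$, where $|\mathcal{G}|$ is the number of vertices. The graph $\mathcal{G}$ is a $c$-expander if $c(\mathcal{G})\ge c$. For a finite group $G$, the product replacement graph $\Gamma_k(G)$ has as vertices all $k$-tuples $(g_1,\dots,g_k)\in G^k$ which generate $G$; for every ordered pair $(i,j)$ with $1\le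 i,j\le k$, $i\ne j$, there are edges corresponding to the transformations $$R_{i,j}^{\pm}:(g_1,\dots,g_i,\dots,g_k)\mapsto(g_1,\dots,g_i\cdot g_j^{\pm1},\dots,g_k),$$ $$L_{i,j}^{\pm}:(g_1,\dots,g_i,\dots,g_k)\mapsto(g_1,\dots,g_j^{\pm1}\cdot g_i,\dots,g_k).$$ This is a regular graph of degree $4k(k-1)$, possibly with loops and multiple edges. *)

(* Defs.v *)
From HB Require Import structures.
From mathcomp Require Import all_boot all_order all_algebra all_fingroup.
From mathcomp Require Import all_classical all_reals all_analysis.

Set Implicit Arguments.
Unset Strict Implicit.
Unset Printing Implicit Defensive.

Import Order.TTheory GRing.Theory Num.Theory.
Local Open Scope group_scope.

(* A finite graph is given by its vertex set V and its adjacency relation e.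
   Loops and the multiplicities of edges are not recorded: they affect neither
   the vertex boundary nor the expansion coefficient. *)
Section Expansion.
Variables (R : realType) (T : finType) (V : {set T}) (e : rel T).

Definition boundary (Y : {set T}) : {set T} :=
  [set x in V :\: Y | [exists y in Y, e x y]].

Definition expansion_ratio (Y : {set T}) : R :=
  (#|boundary Y|%:R / #|Y|%:R)%R.

(* The infimum is taken in the extended reals; it is +oo when no Y is
   admissible, that is, when V has at most two vertices. *)
Definition expansion_coef : \bar R :=
  ereal_inf [set x | exists Y : {set T},
    [/\ Y \subset V, Y != finset.set0, (2 * #|Y| < #|V|)%N
      & x = (expansion_ratio Y)%:E]]%classic.

Definition expander (c : R) : Prop := (c%:E <= expansion_coef)%E.

End Expansion.

Definition symmetric_set (gT : finGroupType) (S : {set gT}) : Prop :=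
  {in S, forall s, s^-1 \in S}.

Definition cayley_rel (gT : finGroupType) (S : {set gT}) : rel gT :=
  fun x y => [exists s in S, x == s * y].

Section ProductReplacement.
Variables (gT : finGroupType) (k : nat).
Implicit Types (t : {ffun 'I_k -> gT}) (i j : 'I_k).

Definition generating_tuples (G : {set gT}) : {set {ffun 'I_k -> gT}} :=
  [set t : {ffun 'I_k -> gT} | <<[set t i | i : 'I_k]>> == G].

(* [inv] selects the exponent -1 of g_j. *)
Definition moveR i j (inv : bool) t : {ffun 'I_k -> gT} :=
  [ffun l => if l == i then t i * (if inv then (t j)^-1 else t j) else t l].

Definition moveL i j (inv : bool) t : {ffun 'I_k -> gT} :=
  [ffun l => if l == i then (if inv then (t j)^-1 else t j) * t i else t l].

Definition product_replacement_rel : rel {ffun 'I_k -> gT} :=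
  fun t u => [exists i, exists j, exists inv,
    (i != j) && ((u == moveR i j inv t) || (u == moveL i j inv t))].

End ProductReplacement.

Lemma cayley_rel_sym (gT : finGroupType) (S : {set gT}) :
  symmetric_set S -> symmetric (cayley_rel S).
Proof.
move=> symS x y; apply/exists_inP/exists_inP => -[s Ss /eqP ->];
  by exists s^-1; rewrite ?symS // mulKg.
Qed.

Lemma product_replacement_rel_sym (gT : finGroupType) (k : nat) :
  symmetric (@product_replacement_rel gT k).
Proof.
suff H t u : @product_replacement_rel gT k t u -> product_replacement_rel u t.
  by move=> t u; apply/idP/idP; apply: H.
case/existsP=> i /existsP[j /existsP[b /andP[nij /orP[]/eqP->]]];
  apply/existsP; exists i; apply/existsP; exists j; apply/existsP;
  exists (~~ b); rewrite nij /=; apply/orP; [left | right];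
  apply/eqP/ffunP => l; rewrite !ffunE eqxx [j == i]eq_sym (negPf nij);
  case: eqP => // ->; case: b => /=;
  by rewrite ?mulgK ?mulgKV ?mulKg ?mulKVg.
Qed.

Definition SL2 (p : nat) : {set {'GL_2(p)}} :=
  [set u : {'GL_2(p)} | (\det (GLval u) == 1)%R].

Lemma SL2_group_set p : group_set (SL2 p).
Proof.
apply/group_setP; split=> [|u v]; first by rewrite inE det1.
by rewrite !inE GL_MxE det_mulmx => /eqP-> /eqP->; rewrite mulr1.
Qed.

Canonical SL2_group p := Group (SL2_group_set p).

(* Main.v *)
Require Import Defs.
From mathcomp Require Import all_boot all_order all_algebra all_fingroup.
From mathcomp Require Import all_solvable finfield.
From mathcomp Require Import zify ring.

Set Implicit Arguments.
Unset Strict Implicit.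
Unset Printing Implicit Defensive.

Import Order.TTheory GRing.Theory Num.Theory.

(* A tuple is redundant at i when its other entries already generate
   G = SL(2, p).  The fibre of such a tuple in direction i is a Cayley graph of
   G, so the hypothesis bounds the number of pairs (t, x) such that t lies in Y
   and replacing t_i by x leaves Y, by a multiple of |G| times the boundary
   of Y.  Hence Y cannot separate tuples that are joined by boundedly many moves
   and resamplings of redundant entries, provided no step is used too often.
   Three facts about G, uniform in p, make such paths exist.
   - Every generating tuple with k >= 4 is redundant after at most six moves.
     In an irredundant tuple all traces are 0, 1 or -1: an entry of order
     divisible by p or of projective order at least 4 would generate G together
     with two others, by the class equation of a proper subgroup.  If this held
     for all nearby tuples, the norm of one entry in the quaternion basis
     1, A, B, BA given by two others of trace 0 would take an impossible value.
   - For every noncentral g, a positive proportion of x satisfies <x, g> = G: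
     the bad x lie on at most 15 hyperplane sections of the quadric det = 1.
   - Hence a redundant entry can be resampled so that two entries generate G;
     all other entries are then redundant, and any two such tuples are joined
     by resampling the coordinates one by one. *)

(** * Expansion of product replacement graphs *)

(** The hypothesis on Cayley graphs speaks only about redundant directions: where every entry is
    needed to generate, no fibre is a Cayley graph of the whole group. Hence redundancy must first
    be created by a number of moves that does not depend on [p]. No list of the subgroups of SL(2,
    p) is used for this. A subgroup [H] of order prime to [p] that contains the centre [Z] has
    abelian centralizers off [Z], each of index at most 2 in its normalizer, and its noncentral
    elements split into blocks of conjugates of such centralizers. In the main case, counting gives
    the equation 1/a + 1/b + 1/c = 1 + 2/|H:Z| of the finite rotation groups, so a centralizer of
    order at least 4|Z| is normal in [H] unless |H:Z| is 24 or 60. With at least four entries, any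
    three still generate a proper subgroup together with [Z]; comparing it with the subgroup of two
    of them removes both exceptions. The six moves are two that make two traces vanish and four for
    the longest word in the final trace computation. *)

Lemma card_bigcup_le (I T : finType) (A : {set I}) (B : I -> {set T}) n :
  (forall i, #|B i| <= n)%N -> (#|\bigcup_(i in A) B i| <= #|A| * n)%N.
Proof.
move=> leB; apply: (@leq_trans (\sum_(i in A) #|B i|)).
  elim/big_ind2: _ => [|U a V b lU lV|i _] //; first by rewrite cards0.
  by rewrite (leq_trans (leq_card_setU _ _)) // leq_add.
by rewrite -sum_nat_const; apply: leq_sum.
Qed.

(** * Redundant tuples and moves *)

Section Moves.
Local Open Scope group_scope.
Variables (gT : finGroupType) (k : nat) (G : {group gT}).
Implicit Types (t u : {ffun 'I_k -> gT}) (i j : 'I_k).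
Local Notation rel := (@product_replacement_rel gT k).

Definition redundant_at i t := (<<[set t j | j : 'I_k & j != i]>> == G :> {set gT})%g.

Fixpoint nearly_redundant n t : bool :=
  if n is n'.+1 then nearly_redundant n' t || [exists u, rel t u && nearly_redundant n' u]
  else [exists i, redundant_at i t].

Lemma nearly_redundant_leq n n' t : (n <= n')%N -> nearly_redundant n t -> nearly_redundant n' t.
Proof.
move=> /subnK <-.
by elim: (n' - n)%N => // d IH /IH; rewrite addSn /= => ->.
Qed.

Lemma generating_tuplesP t :
  reflect (<<[set t i | i : 'I_k]>>%g = G) (t \in generating_tuples k G).
Proof. by rewrite inE; apply: eqP. Qed.

Lemma moveR_rel i j b t : i != j -> rel t (moveR i j b t).
Proof.
move=> ij; apply/existsP; exists i; apply/existsP; exists j; apply/existsP; exists b.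
by rewrite ij eqxx.
Qed.

Lemma rel_gen_sub t u : rel t u -> <<[set u i | i : 'I_k]>>%g \subset <<[set t i | i : 'I_k]>>%g.
Proof.
case/existsP=> i /existsP[j /existsP[b /andP[_ /orP[]/eqP->]]]; rewrite gen_subG;
  apply/subsetP=> _ /imsetP[l _ ->]; rewrite ffunE;
  have T n : t n \in <<[set t i | i : 'I_k]>>%g by rewrite mem_gen // imset_f.
all: by case: (l == i); case: b; rewrite ?groupM ?groupV ?T.
Qed.

Lemma rel_generating t u : rel t u -> t \in generating_tuples k G ->
  u \in generating_tuples k G.
Proof.
move=> tu /generating_tuplesP e; apply/generating_tuplesP; rewrite -e; apply/eqP.
by rewrite eqEsubset !rel_gen_sub // product_replacement_rel_sym.
Qed.

(** A budget of [n] moves: each move spends one, and the tuple reached is still irredundant. Facts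
    about irredundant tuples thus apply to all words of bounded length in the entries. *)
Definition far_from_redundant n t :=
  (t \in generating_tuples k G) && ~~ nearly_redundant n t.

Lemma far_moveR n t i j b :
  i != j -> far_from_redundant n.+1 t -> far_from_redundant n (moveR i j b t).
Proof.
move=> ij /andP[Gt /=]; rewrite negb_or negb_exists => /andP[_ /forallP/(_ (moveR i j b t))].
rewrite moveR_rel //= => nr; rewrite /far_from_redundant nr andbT.
exact: rel_generating (moveR_rel _ _ ij) Gt.
Qed.

Lemma far_leq n n' t : (n <= n')%N -> far_from_redundant n' t -> far_from_redundant n t.
Proof.
by move=> le /andP[Gt nr]; rewrite /far_from_redundant Gt; apply: contra nr;
  apply: nearly_redundant_leq.
Qed.

Lemma generating_mem t i : t \in generating_tuples k G -> t i \in G.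
Proof. by move/generating_tuplesP <-; rewrite mem_gen // imset_f. Qed.

End Moves.

(** * A two-sided isoperimetric inequality for Cayley graphs *)

Section CayleyIsoperimetry.
Local Open Scope group_scope.
Variables (gT : finGroupType) (G : {group gT}) (N d : nat) (S : {set gT}).
Hypotheses (symS : symmetric_set S) (genS : <<S>> = G) (cardS : #|S| <= d).
Hypothesis d_gt0 : 0 < d.
Hypothesis expS : forall A : {set gT}, A \subset G -> A != set0 -> 2 * #|A| < #|G| ->
  #|A| <= N * #|boundary G (cayley_rel S) A|.
Local Notation bd := (boundary G (cayley_rel S)).
Implicit Types A : {set gT}.

Lemma mem_boundary_mul A s y : A \subset G -> s \in S -> y \in A ->
  (s * y \in A) || (s * y \in bd A).
Proof.
move=> sAG Ss Ay; case: (boolP (s * y \in A)) => //= nA.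
rewrite inE in_setD nA /= groupM ?(subsetP sAG y Ay) //=; last first.
  by rewrite -genS mem_gen.
by apply/exists_inP; exists y => //; apply/exists_inP; exists s.
Qed.

(** The [g] that map [A] into itself form a subgroup, and an empty boundary puts [S] into it. *)
Lemma cayley_connected A : A \subset G -> A != set0 -> bd A = set0 -> A = G.
Proof.
move=> sAG /set0Pn[a Aa] bd0; pose B := [set g | [forall y in A, g * y \in A]].
have BP g : reflect {in A, forall y, g * y \in A} (g \in B).
  by rewrite inE; apply: forall_inP.
have gB : group_set B.
  apply/group_setP; split=> [|x y /BP hx /BP hy]; apply/BP => z Az.
    by rewrite mul1g.
  by rewrite -mulgA; apply/hx/hy.
have sGB : G \subset group gB.
  rewrite -genS gen_subG; apply/subsetP=> s Ss; apply/BP => y Ay.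
  by have := mem_boundary_mul sAG Ss Ay; rewrite bd0 inE orbF.
apply/eqP; rewrite eqEsubset sAG; apply/subsetP=> g Gg.
have Ga := subsetP sAG a Aa.
have /(subsetP sGB) /BP /(_ a Aa) : g * a^-1 \in G by rewrite groupM ?groupV.
by rewrite mulgKV.
Qed.

(** Nothing tells whether [Y] occupies more or less than half of a fibre, so the inequality has to
    be symmetric in [A] and its complement. The factor [d] compares their boundaries: a boundary
    point of the complement is a neighbour of a boundary point of [A]. *)
Lemma cayley_isoperimetry A : A \subset G ->
  #|A| * #|G :\: A| <= (N.*2.+1 * d) * #|G| * #|bd A|.
Proof.
move=> sAG; set C := N.*2.+1; pose A' := G :\: A.
have cA' : #|A| + #|A'| = #|G|.
  by rewrite -(cardsID A G) (setIidPr sAG).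
have [A0|A0] := eqVneq A set0; first by rewrite A0 cards0.
have [A'0|A'0] := eqVneq A' set0; first by rewrite -/A' A'0 cards0 muln0.
suff [h|h] : #|A| <= C * d * #|bd A| \/ #|A'| <= C * d * #|bd A|.
- by rewrite mulnAC -/A' leq_mul // -cA' leq_addl.
- by rewrite mulnAC mulnC -/A' leq_mul // -cA' leq_addr.
have bA' : #|bd A'| <= #|bd A| * d.
  apply: leq_trans (_ : #|\bigcup_(y in bd A) [set s * y | s in S]| <= _); last first.
    by apply: card_bigcup_le => y; apply: leq_trans (leq_imset_card _ _) cardS.
  apply/subset_leq_card/subsetP=> x;
    rewrite inE => /andP[xA' /exists_inP[y yA' /exists_inP[s Ss /eqP xe]]].
  have xA : x \in A by move: xA'; rewrite !inE; case: (x \in A) => //=; case: (x \in G).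
  apply/bigcupP; exists y; last by apply/imsetP; exists s.
  have := mem_boundary_mul sAG (symS Ss) xA; rewrite xe mulKg.
  by case/setDP: yA' => _ /negPf ->.
have [lt|gt|eq] := ltngtP (2 * #|A|) #|G|.
- left; apply: leq_trans (expS sAG A0 lt) _; rewrite leq_mul2r; apply/orP; right.
  by rewrite /C; nia.
- right; have lt' : 2 * #|A'| < #|G| by lia.
  apply: leq_trans (expS (subsetDl _ _) A'0 lt') _; rewrite -/A' /C.
  by apply: leq_trans (leq_mul (leqnn N) bA') _; nia.
(* Expansion is given only strictly below one half. At exactly half, a point [a] is removed: the
   boundary gains at most [a], and being nonempty by connectedness it at most doubles. Hence the
   constant 2N + 1. *)
left; have b0 : 0 < #|bd A|.
  rewrite card_gt0; apply: contra A'0 => /eqP b0.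
  by rewrite /A' (cayley_connected sAG A0 b0) setDv.
have [a Aa] := set0Pn _ A0; have cA := cardsD1 a A; rewrite Aa in cA.
have [B0|B0] := eqVneq (A :\ a) set0.
  by rewrite B0 cards0 in cA; rewrite cA /C; nia.
have sB : A :\ a \subset G by apply: subset_trans (subsetDl _ _) sAG.
have lt : 2 * #|A :\ a| < #|G| by lia.
have eB := expS sB B0 lt.
have bB : #|bd (A :\ a)| <= 1 + #|bd A|.
  rewrite -(cards1 a); apply: leq_trans (leq_card_setU _ _).
  apply/subset_leq_card/subsetP=> x;
    rewrite inE => /andP[/setDP[Gx nx] /exists_inP[y /setD1P[_ Ay] e]].
  rewrite !inE; have [//|xa] := eqVneq x a; move: nx; rewrite !inE xa /= => nA.
  by rewrite nA Gx /=; apply/exists_inP; exists y.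
have h1 : #|A :\ a| <= N * (2 * #|bd A|).
  by apply: leq_trans eB _; rewrite leq_mul2l; apply/orP; right; lia.
apply: (@leq_trans (C * #|bd A|)); first by rewrite /C; lia.
by rewrite -mulnA leq_mul2l leq_pmull ?orbT.
Qed.

End CayleyIsoperimetry.

(** * Fibres of the product replacement graph *)

Section Lines.
Local Open Scope group_scope.
Variables (gT : finGroupType) (k : nat) (G : {group gT}).
Implicit Types (t u s : {ffun 'I_k -> gT}) (i j l : 'I_k).
Implicit Types (Y P Q : {set {ffun 'I_k -> gT}}).
Local Notation rel := (@product_replacement_rel gT k).
Local Notation V := (generating_tuples k G).
Local Notation bd := (boundary V rel).

Definition update t i x : {ffun 'I_k -> gT} := [ffun l => if l == i then x else t l].

Lemma update_id t i : update t i (t i) = t.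
Proof. by apply/ffunP=> l; rewrite ffunE; case: eqP => // ->. Qed.

Lemma update_update t i x y : update (update t i x) i y = update t i y.
Proof. by apply/ffunP=> l; rewrite !ffunE; case: eqP. Qed.

Lemma update_eq t i x : update t i x i = x.
Proof. by rewrite ffunE eqxx. Qed.

Lemma update_neq t i x l : l != i -> update t i x l = t l.
Proof. by rewrite ffunE => /negPf ->. Qed.

Lemma update_inj t i : injective (update t i).
Proof. by move=> x y /(congr1 (fun t : {ffun _} => t i)); rewrite !update_eq. Qed.

Lemma redundant_update t i x : redundant_at G i (update t i x) = redundant_at G i t.
Proof.
rewrite /redundant_at (_ : [set _ j | j : _ & _] = [set t j | j : 'I_k & j != i]) //.
apply/setP=> y; apply/imsetP/imsetP => -[l]; rewrite inE => li ->;
  by exists l; rewrite ?inE ?update_neq.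
Qed.

Lemma redundant_generating t i x : redundant_at G i t -> x \in G -> update t i x \in V.
Proof.
move=> /eqP e Gx; apply/generating_tuplesP/eqP; rewrite eqEsubset; apply/andP; split.
  rewrite gen_subG; apply/subsetP=> _ /imsetP[l _ ->]; rewrite ffunE; case: eqP => // /eqP li.
  by rewrite -e mem_gen // imset_f // inE.
rewrite -{1}e; apply: genS; apply/subsetP=> _ /imsetP[l li ->]; rewrite inE in li.
by apply/imsetP; exists l; rewrite ?update_neq.
Qed.

Definition line_set Y t i := [set x in G | update t i x \in Y].

(** Left moves with target [i] multiply entry [i] on the left by these elements, which makes them
    the edges of a Cayley graph on the fibre. *)
Definition line_gens t i := [set t j | j : 'I_k & j != i] :|: [set (t j)^-1 | j : 'I_k & j != i].

Lemma line_gens_sym t i : symmetric_set (line_gens t i).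
Proof.
move=> s; rewrite !inE => /orP[]/imsetP[j ji ->]; apply/orP; [right|left]; apply/imsetP;
  by exists j; rewrite ?invgK.
Qed.

Lemma line_gens_gen t i : redundant_at G i t -> <<line_gens t i>> = G.
Proof.
move=> /eqP e; apply/eqP; rewrite eqEsubset; apply/andP; split.
  rewrite gen_subG subUset -{1}e subset_gen /=; apply/subsetP=> _ /imsetP[j ji ->].
  by rewrite groupV -e mem_gen // imset_f.
by rewrite -{1}e genS // subsetUl.
Qed.

Lemma card_line_gens t i : #|line_gens t i| <= k.*2.
Proof.
rewrite -addnn; apply: leq_trans (leq_card_setU _ _) _; apply: leq_add;
  by apply: leq_trans (leq_imset_card _ _) _; rewrite -[X in _ <= X]card_ord max_card.
Qed.

Lemma line_boundary Y t i x : Y \subset V -> redundant_at G i t ->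
  x \in boundary G (cayley_rel (line_gens t i)) (line_set Y t i) ->
  update t i x \in bd Y.
Proof.
move=> sYV red; rewrite inE => /andP[/setDP[Gx nx] /exists_inP[y]].
rewrite inE => /andP[Gy Yy] /exists_inP[s Ss /eqP xe].
rewrite inE in_setD redundant_generating // andbT; apply/andP; split.
  by move: nx; rewrite inE Gx.
apply/exists_inP; exists (update t i y) => //; rewrite product_replacement_rel_sym.
suff [j [b [ji e]]] : exists j b, j != i /\ s = (if b then (t j)^-1 else t j).
  apply/existsP; exists i; apply/existsP; exists j; apply/existsP; exists b.
  rewrite eq_sym ji; apply/orP; right; apply/eqP/ffunP => l.
  by rewrite !ffunE eqxx (negPf ji); case: eqP => // _; rewrite xe e.
move: Ss; rewrite !inE => /orP[]/imsetP[j]; rewrite inE => ji ->.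
  by exists j, false.
by exists j, true.
Qed.

Variable N : nat.
Hypothesis k_gt0 : 0 < k.
Hypothesis expG : forall S, symmetric_set S -> <<S>> = G ->
  forall A : {set gT}, A \subset G -> A != set0 -> 2 * #|A| < #|G| ->
  #|A| <= N * #|boundary G (cayley_rel S) A|.

Definition line_const := (N.*2.+1 * k.*2)%N.

Definition crossing Y i := \sum_(t in Y | redundant_at G i t) #|G :\: line_set Y t i|.

Lemma line_set_update Y t i x : line_set Y (update t i x) i = line_set Y t i.
Proof. by apply/setP=> y; rewrite !inE update_update. Qed.

(** Each fibre is labelled by its member with entry 1 at [i]. If [Y] meets it in [A], it contributes
    |A| |G - A| to the crossing and at least the boundary of [A] to that of [Y]; the isoperimetric
    inequality is summed over the disjoint fibres. *)
Lemma crossing_le Y i : Y \subset V -> crossing Y i <= line_const * #|G| * #|bd Y|.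
Proof.
move=> sYV; pose base t := update t i 1.
have -> : #|bd Y| = \sum_s #|[set u in bd Y | base u == s]|.
  rewrite -sum1_card (partition_big base predT) //=; apply: eq_bigr => s _.
  by rewrite -sum1_card; apply: eq_bigl => u; rewrite !inE.
rewrite /crossing (partition_big base predT) //= big_distrr; apply: leq_sum => s _.
have [red|nred] := boolP (redundant_at G i s); last first.
  rewrite big_pred0 // => t; apply/negP => /andP[/andP[_ rt] /eqP e].
  by move: nred; rewrite -e redundant_update rt.
have [|nbase] := boolP (s == base s); last first.
  rewrite big_pred0 // => t; apply/negP => /andP[_ /eqP e].
  by move: nbase; rewrite -e /base update_update eqxx.
move/eqP=> bs; rewrite (eq_bigr (fun=> #|G :\: line_set Y s i|)); last first.
  by move=> t /andP[_ /eqP <-]; rewrite line_set_update.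
rewrite sum_nat_const.
have sAG : line_set Y s i \subset G by apply/subsetP=> x; rewrite inE => /andP[].
have dk : 0 < k.*2 by rewrite double_gt0.
have symS := @line_gens_sym s i; have genS := line_gens_gen red.
have := cayley_isoperimetry symS genS (card_line_gens s i) dk (expG symS genS) sAG.
move=> iso; apply: leq_trans (leq_trans iso _).
  rewrite leq_mul2r; apply/orP; right.
  rewrite -(card_in_imset (f := fun t : {ffun 'I_k -> gT} => t i)); last first.
    move=> t u /andP[_ /eqP et] /andP[_ /eqP eu] e.
    by rewrite -(update_id t i) -(update_id u i) e -(update_update t i 1) -(update_update u i
      1) -/(base _) et -eu.
  apply/subset_leq_card/subsetP=> _ /imsetP[t tP ->].
  have /andP[/andP[Yt rt] /eqP e] := tP.
  rewrite inE (generating_mem i (subsetP sYV t Yt)) -e update_update update_id Yt //.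
rewrite leq_mul2l; apply/orP; right.
rewrite -(card_imset _ (@update_inj s i)); apply/subset_leq_card/subsetP=> _ /imsetP[x bx ->].
by rewrite inE (line_boundary sYV red bx) /base update_update [X in X == _](esym bs) eqxx.
Qed.

End Lines.

(** * Resampling redundant entries *)

Section Transport.
Local Open Scope group_scope.
Variables (gT : finGroupType) (k : nat) (G : {group gT}) (N N2 : nat).
Implicit Types (t u s : {ffun 'I_k -> gT}) (i j l : 'I_k).
Implicit Types (Y P Q A B : {set {ffun 'I_k -> gT}}).
Local Notation rel := (@product_replacement_rel gT k).
Local Notation V := (generating_tuples k G).
Local Notation bd := (boundary V rel).

Hypothesis k_gt3 : 3 < k.
Hypothesis expG : forall S, symmetric_set S -> <<S>> = G ->
  forall A : {set gT}, A \subset G -> A != set0 -> 2 * #|A| < #|G| ->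
  #|A| <= N * #|boundary G (cayley_rel S) A|.
Hypothesis nabG : ~~ abelian G.
Hypothesis cogenG : forall g, g \in G -> g \notin 'Z(G) ->
  #|G| <= N2 * #|[set x in G | <<[set x; g]>> == G]|.
Local Notation line_const := (line_const k N).

Let k_gt0 : 0 < k. Proof. exact: leq_trans k_gt3. Qed.

(** Exchanging the old and the new value, (t, x) to ([update t i x], [t i]), is injective, so each
    tuple of [B] is reached at most |G| times. *)
Lemma sum_line_set A B i : (forall t, t \in A -> t i \in G) ->
  \sum_(t in A) #|line_set G B t i| <= #|B| * #|G|.
Proof.
move=> AG; rewrite (eq_bigr (fun t => \sum_(x in line_set G B t i) 1)); last first.
  by move=> t _; rewrite sum1_card.
rewrite pair_big_dep /= sum1dep_card -cardsX.
rewrite -(card_in_imset (f := fun q => (update q.1 i q.2, q.1 i))).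
  apply/subset_leq_card/subsetP=> _ /imsetP[[t x] tx ->].
  move: tx; rewrite !inE /= => /andP[At /andP[Gx Bx]].
  by rewrite Bx AG.
move=> [t x] [u y] _ _ /= [e1 e2].
have exy : x = y by rewrite -(update_eq t i x) e1 update_eq.
by rewrite exy -(update_id t i) -(update_id u i) e2 -(update_update t i x) e1 update_update.
Qed.

(** At least a proportion 1/N2 of the resamplings of [t] at [i] lands in [Q]. Those leaving [Y] are
    paid for by [crossing]; the others land in [Y :&: Q] and are paid for by [sum_line_set]. *)
Lemma transport P Q i Y : Y \subset V ->
    (forall t, t \in P -> t \in V -> redundant_at G i t /\
      #|G| <= N2 * #|line_set G Q t i|) ->
  #|Y :&: P| <= N2 * (line_const * #|bd Y| + #|Y :&: Q|).
Proof.
move=> sYV PQ; rewrite -(leq_pmul2r (cardG_gt0 G)) -sum_nat_const.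
apply: leq_trans (_ : \sum_(t in Y :&: P) N2 * (#|G :\: line_set G Y t i| + #|line_set G (Y
  :&: Q) t i|) <= _).
  apply: leq_sum => t /setIP[Yt Pt]; have [_ le] := PQ t Pt (subsetP sYV t Yt).
  apply: leq_trans le _; rewrite leq_mul2l; apply/orP; right.
  apply: leq_trans (leq_card_setU _ _); apply/subset_leq_card/subsetP=> x; rewrite !inE.
  by case: (x \in G) => //= ->; rewrite andbT; case: (_ \in Y).
rewrite -big_distrr -mulnA leq_mul2l; apply/orP; right; rewrite big_split mulnDl leq_add //.
  rewrite mulnAC; apply: leq_trans (crossing_le k_gt0 expG i sYV).
  rewrite /crossing big_mkcond [X in _ <= X]big_mkcond; apply: leq_sum => t _.
  rewrite inE; case: (boolP (t \in Y)) => //= Yt; case: (boolP (t \in P)) => //= Pt.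
  by have [-> _] := PQ t Pt (subsetP sYV t Yt).
apply: sum_line_set => t /setIP[Yt _]; exact: (generating_mem i (subsetP sYV t Yt)).
Qed.

Definition core i j := [set t in V | <<[set t i; t j]>> == G].

Definition cores := \bigcup_(q : 'I_k * 'I_k | q.1 != q.2) core q.1 q.2.

Lemma coreC i j : core i j = core j i.
Proof. by apply/setP=> t; rewrite !inE setUC. Qed.

Lemma core_redundant t i j l : t \in core i j -> l != i -> l != j -> redundant_at G l t.
Proof.
rewrite inE => /andP[Vt /eqP e] li lj; rewrite /redundant_at eqEsubset.
apply/andP; split.
  by rewrite gen_subG; apply/subsetP=> _ /imsetP[n _ ->]; apply: generating_mem Vt.
rewrite -{1}e; apply: genS; apply/subsetP=> _ /set2P[]->; apply: imset_f;
  by rewrite inE eq_sym.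
Qed.

Lemma core_noncentral t i j : t \in core i j -> t i \notin 'Z(G).
Proof.
rewrite inE => /andP[Vt /eqP e]; apply: contra nabG => /setIP[Gi /centP ci].
rewrite -{1}e abelian_gen; apply/centsP=> x /set2P[]-> y /set2P[]->; rewrite /commute //.
  by rewrite ci // (generating_mem j Vt).
by rewrite ci // (generating_mem j Vt).
Qed.

Lemma line_core t i j : redundant_at G i t -> i != j -> t j \in G -> t j \notin 'Z(G) ->
  #|G| <= N2 * #|line_set G (core i j) t i|.
Proof.
move=> red ij Gj nZ; apply: leq_trans (cogenG Gj nZ) _; rewrite leq_mul2l; apply/orP; right.
apply/subset_leq_card/subsetP=> x; rewrite !in_set => /andP[Gx e].
rewrite Gx update_eq update_neq ?e ?andbT /=; last by rewrite eq_sym.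
by have := redundant_generating red Gx; rewrite inE.
Qed.

(** Entry [l] is resampled against entry [i], which is noncentral because it belongs to a pair
    generating a nonabelian group. *)
Lemma core_core Y i j l : Y \subset V -> l != i -> l != j ->
  #|Y :&: core i j| <= N2 * (line_const * #|bd Y| + #|Y :&: core i l|).
Proof.
move=> sYV li lj; apply: (transport (i := l)) => // t ct Vt.
have red := core_redundant ct li lj; split=> //; rewrite (coreC i l).
by apply: line_core => //; [apply: generating_mem | apply: core_noncentral ct].
Qed.

(** The entries other than [i] generate a nonabelian group, so one of them is noncentral and has
    many cogenerators to put at [i]. *)
Lemma redundant_cores Y i : Y \subset V ->
  #|Y :&: [set t | redundant_at G i t]| <= N2 * (line_const * #|bd Y| + #|Y :&: cores|).
Proof.
move=> sYV; apply: (transport (i := i)) => // t; rewrite inE => red Vt; split=> //.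
have [j ij nZ] : exists2 j, i != j & t j \notin 'Z(G).
  apply/exists_inP; rewrite -[X in is_true X]negbK negb_exists_in;
    apply: contra nabG => /forall_inP h.
  apply: abelianS (center_abelian G); rewrite -{1}(eqP red) gen_subG.
  apply/subsetP=> _ /imsetP[j ji ->]; rewrite inE in ji.
  by rewrite -[_ \in _]negbK h // eq_sym.
apply: leq_trans (line_core red ij (generating_mem j Vt) nZ) _.
rewrite leq_mul2l; apply/orP; right; apply/subset_leq_card/subsetP=> x.
rewrite [in X in X -> _]inE [in X in _ -> X]inE => /andP[-> c] /=; apply/bigcupP.
by exists (i, j).
Qed.

Lemma N2_gt0 : 0 < N2.
Proof.
have [g Gg nZ] : exists2 g, g \in G & g \notin 'Z(G).
  apply/subsetPn; apply: contra nabG => sGZ; apply: abelianS sGZ (center_abelian G).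
by have := cogenG Gg nZ; case: (N2) => //; rewrite mul0n leqNgt cardG_gt0.
Qed.

Definition resample_bound x D := (N2 * (line_const * D + x))%N.

Lemma resample_bound_le D x y : x <= y -> resample_bound x D <= resample_bound y D.
Proof. by move=> le; rewrite leq_mul2l leq_add2l le orbT. Qed.

Lemma leq_resample_bound D x : x <= resample_bound x D.
Proof.
apply: leq_trans (leq_pmull _ N2_gt0); rewrite leq_addl //.
Qed.

(** Two resamplings suffice: from the pair (i, j) to (i, a), then to (a, b). If the pairs overlap in
    [a], at most one is needed. *)
Lemma core_any_core Y i j a b : Y \subset V -> i != j -> a != b ->
  #|Y :&: core i j| <= resample_bound (resample_bound #|Y :&: core a b| #|bd Y|) #|bd Y|.
Proof.
move=> sYV; set D := #|bd Y|.
have S1 i' j' l' : l' != i' -> l' != j' ->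
  #|Y :&: core i' j'| <= resample_bound #|Y :&: core i' l'| D.
  by move=> ? ?; apply: core_core.
have fromA j' : j' != a -> a != b -> #|Y :&: core a j'| <= resample_bound #|Y :&: core a b| D.
  move=> ja ab; have [->|jb] := eqVneq j' b; first exact: leq_resample_bound.
  by apply: S1; rewrite eq_sym.
move=> ij ab; have [ia|ia] := eqVneq i a.
  rewrite ia in ij *; apply: leq_trans (fromA j _ ab) (leq_resample_bound _ _).
  by rewrite eq_sym.
have [ja|ja] := eqVneq j a.
  rewrite ja in ij *; rewrite coreC; apply: leq_trans (fromA i ij ab) (leq_resample_bound _ _).
apply: leq_trans (S1 i j a _ _) _; rewrite 1?eq_sym //.
by rewrite coreC resample_bound_le // fromA.
Qed.

End Transport.

(** Here [y], [y'] are the sizes of a set and its complement, [a], [b] those of their core parts,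
    [D], [D'] the boundaries and [W] the size of G^k. Multiplying the bounds on [y] and [y'] makes
    every term at most a multiple of D W; as [W] is at most a multiple of [y'], cancelling [y']
    leaves a bound linear in [D]. *)
Lemma isoperimetry_arith y y' a b D D' W K d c e : (y < y' ->
  y <= K * (a + D) -> y' <= K * (b + D') -> D' <= D * d -> a * b <= c * D * W ->
  W <= 2 * e * (y + y') -> a <= W -> b <= W -> D <= W ->
  y <= K * K * (d.*2.+1 + c) * (4 * e) * D)%N.
Proof.
move=> lt h1 h2 h3 h4 h5 w1 w2 w3; have y'0 : (0 < y')%N by lia.
rewrite -(leq_pmul2r y'0).
apply: (@leq_trans (K * K * ((a + D) * (b + D')))).
  by rewrite mulnACA; apply: leq_mul.
have e1 : ((a + D) * (b + D') <= (d.*2.+1 + c) * (D * W))%N.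
  have t1 : (a * D' <= d * (D * W))%N.
    by rewrite mulnA mulnC; apply: leq_mul => //; rewrite mulnC.
  have t2 : (D * D' <= d * (D * W))%N.
    by rewrite mulnA mulnC; apply: leq_mul => //; rewrite mulnC.
  have t3 : (D * b <= D * W)%N by rewrite leq_mul2l w2 orbT.
  have t4 : (a * b <= c * (D * W))%N by rewrite mulnA.
  rewrite mulnDl !mulnDr mulnDl -addnn mulSn mulnDl; lia.
have e2 : (W <= 4 * e * y')%N.
  apply: leq_trans h5 _; rewrite (_ : 4 * e * y' = 2 * e * (2 * y'))%N; last by lia.
  by rewrite leq_mul2l; apply/orP; right; lia.
apply: (@leq_trans (K * K * ((d.*2.+1 + c) * (D * (4 * e * y'))))).
  rewrite leq_mul2l; apply/orP; right; apply: leq_trans e1 _.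
  by rewrite !leq_mul2l e2 !orbT.
by move: (d.*2.+1 + c)%N => q; lia.
Qed.

(** * Isoperimetry by interpolation between generating tuples *)

Section Expansion.
Local Open Scope group_scope.
Variables (gT : finGroupType) (k : nat) (G : {group gT}) (N N2 L : nat).
Implicit Types (t u s w : {ffun 'I_k -> gT}) (i j l : 'I_k).
Implicit Types (Y P Q A B : {set {ffun 'I_k -> gT}}).
Local Notation rel := (@product_replacement_rel gT k).
Local Notation V := (generating_tuples k G).
Local Notation bd := (boundary V rel).

Definition degree := (k * k * 4)%N.

Lemma card_neighbours t : #|[set u | rel u t]| <= degree.
Proof.
pose f (q : 'I_k * 'I_k * (bool * bool)) :=
  if q.2.1 then moveR q.1.1 q.1.2 q.2.2 t else moveL q.1.1 q.1.2 q.2.2 t.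
apply: leq_trans (_ : #|[set f q | q : 'I_k * 'I_k * (bool * bool)]| <= _); last first.
  by apply: leq_trans (leq_imset_card _ _) _; rewrite !card_prod !card_ord card_bool.
apply/subset_leq_card/subsetP=> u; rewrite inE product_replacement_rel_sym.
case/existsP=> i /existsP[j /existsP[b /andP[_ /orP[]/eqP->]]].
  by apply/imsetP; exists (i, j, (true, b)).
by apply/imsetP; exists (i, j, (false, b)).
Qed.

Lemma boundary_compl_le Y : Y \subset V -> #|bd (V :\: Y)| <= #|bd Y| * degree.
Proof.
move=> sYV; apply: leq_trans (_ : #|\bigcup_(u in bd Y) [set t | rel t u]| <= _); last first.
  by apply: card_bigcup_le => u; apply: card_neighbours.
apply/subset_leq_card/subsetP=> t; rewrite inE => /andP[tV /exists_inP[u uV tu]].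
have Yt : t \in Y.
  by move: tV; rewrite in_setD in_setD negb_and negbK => /andP[/orP[//|/negPf->]].
apply/bigcupP; exists u; last by rewrite inE.
rewrite inE uV; apply/exists_inP; exists t => //.
by rewrite product_replacement_rel_sym.
Qed.

Lemma nearly_redundantS n t : nearly_redundant G n.+1 t =
  nearly_redundant G n t || [exists u, rel t u && nearly_redundant G n u].
Proof. by []. Qed.

(** The neighbour of [t] that is closer to redundancy lies in [Y] or in its boundary. With the
    boundary added on both sides the bound can be iterated. *)
Lemma card_nearly_redundantS Y n : Y \subset V ->
  #|Y :&: [set t | nearly_redundant G n.+1 t]| + #|bd Y| <=
    degree.+2 * (#|Y :&: [set t | nearly_redundant G n t]| + #|bd Y|).
Proof.
move=> sYV; set a := #|Y :&: [set t | nearly_redundant G n t]|.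
suff : #|Y :&: [set t | nearly_redundant G n.+1 t]| <= a + (a + #|bd Y|) * degree.
  by move: #|_| #|bd Y| => x y; nia.
apply: leq_trans (_ : #|(Y :&: [set t | nearly_redundant G n t]) :|:
  \bigcup_(u in (Y :&: [set t | nearly_redundant G n t]) :|: bd Y) [set t | rel t u]| <= _).
  apply/subset_leq_card/subsetP=> t /setIP[Yt]; rewrite in_set nearly_redundantS.
  case/orP=> [nt|/existsP[u /andP[tu nu]]]; first by rewrite in_setU in_setI Yt in_set nt.
  rewrite in_setU; apply/orP; right; apply/bigcupP; exists u; last by rewrite inE.
  rewrite in_setU; have [Yu|nYu] := boolP (u \in Y); first by rewrite in_setI Yu in_set nu.
  apply/orP; right; rewrite inE in_setD nYu (rel_generating tu) ?(subsetP sYV t Yt) //.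
  by apply/exists_inP; exists t => //; rewrite product_replacement_rel_sym.
apply: leq_trans (leq_card_setU _ _) _; rewrite leq_add2l.
apply: leq_trans (card_bigcup_le _ card_neighbours) _.
by rewrite leq_mul2r leq_card_setU orbT.
Qed.

Hypothesis nearG : forall t, t \in V -> nearly_redundant G L t.

Lemma card_nearly_redundant Y : Y \subset V ->
  #|Y| <= degree.+2 ^ L * (#|Y :&: [set t | nearly_redundant G 0 t]| + #|bd Y|).
Proof.
move=> sYV; have le n : #|Y :&: [set t | nearly_redundant G n t]| + #|bd Y| <=
    degree.+2 ^ n * (#|Y :&: [set t | nearly_redundant G 0 t]| + #|bd Y|).
  elim: n => [|n IH]; first by rewrite mul1n.
  apply: leq_trans (card_nearly_redundantS n sYV) _; rewrite expnS -mulnA leq_mul2l IH orbT //.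
apply: leq_trans (le L); rewrite (_ : Y :&: _ = Y) ?leq_addr //.
by apply/setIidPl/subsetP=> t Yt; rewrite inE nearG // (subsetP sYV).
Qed.

Hypothesis k_gt3 : 3 < k.
Hypothesis expG : forall S, symmetric_set S -> <<S>> = G ->
  forall A : {set gT}, A \subset G -> A != set0 -> 2 * #|A| < #|G| ->
  #|A| <= N * #|boundary G (cayley_rel S) A|.
Hypothesis nabG : ~~ abelian G.
Hypothesis cogenG : forall g, g \in G -> g \notin 'Z(G) ->
  #|G| <= N2 * #|[set x in G | <<[set x; g]>> == G]|.
Local Notation line_const := (line_const k N).
Local Notation resample_bound := (resample_bound k N N2).
Let k_gt0 : 0 < k. Proof. exact: leq_trans k_gt3. Qed.

Lemma card_redundant Y : Y \subset V ->
  #|Y :&: [set t | nearly_redundant G 0 t]| <= k * resample_bound #|Y :&: cores k G| #|bd Y|.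
Proof.
move=> sYV; apply: leq_trans (_ :
  #|\bigcup_(i in [set: 'I_k]) (Y :&: [set t | redundant_at G i t])| <= _).
  apply/subset_leq_card/subsetP=> t; rewrite 2!inE => /andP[Yt /existsP[i ri]].
  by apply/bigcupP; exists i; rewrite ?inE // Yt.
apply: leq_trans (card_bigcup_le _ (n := resample_bound #|Y :&: cores k G| #|bd Y|) _) _ => [i|].
  exact: (redundant_cores k_gt3 expG nabG cogenG).
by rewrite cardsT card_ord.
Qed.

Lemma cores_le Y a b : Y \subset V -> a != b ->
  #|Y :&: cores k G| <=
    k * k * resample_bound (resample_bound #|Y :&: core G a b| #|bd Y|) #|bd Y|.
Proof.
move=> sYV ab; set c := resample_bound _ _.
apply: leq_trans (_ : #|\bigcup_(q in [set: 'I_k * 'I_k])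
   (if q.1 != q.2 then Y :&: core G q.1 q.2 else set0)| <= _).
  apply/subset_leq_card/subsetP=> t; rewrite inE => /andP[Yt /bigcupP[q q12 ct]].
  by apply/bigcupP; exists q; rewrite ?inE // q12 inE Yt.
apply: leq_trans (card_bigcup_le _ (n := c) _) _ => [q|].
  case: ifP => [q12|_]; last by rewrite cards0.
  exact: (core_any_core k_gt3 expG nabG cogenG).
by rewrite cardsT card_prod card_ord.
Qed.

Definition step_const := (N2 * line_const.+1).+1.
(** The losses on the way to one core, in order: [L] moves to redundancy, the choice of a redundant
    direction, a resampling into some core, the choice of that core, two resamplings to the
    prescribed pair. *)
Definition core_const :=
  (degree.+2 ^ L * (k * (step_const * (k * k * (step_const * step_const)))))%N.

Lemma card_le_core Y a b : Y \subset V -> a != b ->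
  #|Y| <= core_const * (#|Y :&: core G a b| + #|bd Y|).
Proof.
move=> sYV ab; apply: leq_trans (card_nearly_redundant sYV) _;
  rewrite /core_const -[leqRHS]mulnA leq_mul2l; apply/orP; right.
have := card_redundant sYV; have := cores_le sYV ab.
set D := #|bd Y|; set x := #|Y :&: core G a b|; set c := #|Y :&: cores k G|; set r := #|_|.
move=> hc hr; have hs y : resample_bound y D + D <= step_const * (y + D).
  rewrite /resample_bound /step_const mulSn addnC [y + D]addnC -addnA leq_add2l.
  apply: leq_trans (leq_addl _ _); rewrite -[leqRHS]mulnA leq_mul2l; apply/orP; right.
  rewrite mulSn; move: (line_const) => q; nia.
have hk q y : 0 < q -> q * y + D <= q * (y + D) by move=> q0; rewrite mulnDr leq_add2l leq_pmull.
apply: leq_trans (_ : k * (resample_bound c D + D) <= _).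
  by apply: leq_trans (hk _ _ k_gt0); rewrite leq_add2r.
rewrite -[leqRHS]mulnA leq_mul2l; apply/orP; right; apply: leq_trans (hs c) _.
rewrite -[leqRHS]mulnA leq_mul2l; apply/orP; right.
apply: leq_trans (_ : k * k * (resample_bound (resample_bound x D) D + D) <= _).
  by apply: leq_trans (hk _ _ _); rewrite ?leq_add2r // muln_gt0 k_gt0.
rewrite -[leqRHS]mulnA leq_mul2l; apply/orP; right; apply: leq_trans (hs _) _.
by rewrite -[leqRHS]mulnA leq_mul2l hs orbT.
Qed.

Definition tuples_in : {set {ffun 'I_k -> gT}} := [set t : {ffun _} | [forall l, t l \in G]].

Lemma tuples_inP t : reflect (forall l, t l \in G) (t \in tuples_in).
Proof. by rewrite inE; apply: forallP. Qed.

Lemma generating_tuples_in : V \subset tuples_in.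
Proof. by apply/subsetP=> t Vt; apply/tuples_inP=> l; apply: generating_mem Vt. Qed.

Lemma pair_redundant w i j l : w \in tuples_in -> <<[set w i; w j]>> = G ->
  l != i -> l != j -> redundant_at G l w.
Proof.
move=> /tuples_inP wG e li lj; apply: (core_redundant (i := i) (j := j)) => //.
rewrite inE e eqxx andbT; apply/generating_tuplesP/eqP; rewrite eqEsubset; apply/andP; split.
  by rewrite gen_subG; apply/subsetP=> _ /imsetP[n _ ->].
by rewrite -{1}e; apply: genS; apply/subsetP=> _ /set2P[]->; apply: imset_f.
Qed.

Definition i0 : 'I_k := Ordinal k_gt0.
Definition i1 : 'I_k := Ordinal (ltn_trans (isT : 1 < 3) k_gt3).
Definition i2 : 'I_k := Ordinal (ltn_trans (isT : 2 < 3) k_gt3).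
Definition i3 : 'I_k := Ordinal k_gt3.

(** The path count involves all of G^k, so generating tuples must fill a positive proportion of it.
    A noncentral entry 0 is completed by a proportion 1/N2 of the values of entry 1, and
    multiplication by a noncentral [g] shows that at least half of the tuples have entry 0
    noncentral. *)
Lemma card_tuples_in : #|tuples_in| <= 2 * N2 * #|V|.
Proof.
pose P := [set t in tuples_in | t i0 \notin 'Z(G)].
have leP : #|P| <= N2 * #|V|.
  rewrite -(leq_pmul2r (cardG_gt0 G)) -sum_nat_const.
  apply: leq_trans (_ : \sum_(t in P) N2 * #|line_set G V t i1| <= _).
    apply: leq_sum => t; rewrite inE => /andP[/tuples_inP tG nZ].
    apply: leq_trans (cogenG (tG i0) nZ) _; rewrite leq_mul2l; apply/orP; right.
    apply/subset_leq_card/subsetP=> x; rewrite !in_set => /andP[Gx /eqP e]; rewrite Gx /=.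
    rewrite eqEsubset; apply/andP; split.
      rewrite gen_subG; apply/subsetP=> _ /imsetP[l _ ->]; rewrite ffunE.
      by case: eqP => // _; apply: tG.
    rewrite -{1}e; apply: genS; apply/subsetP=> _ /set2P[]->; apply/imsetP.
      by exists i1; rewrite ?update_eq.
    by exists i0; rewrite ?update_neq.
  rewrite -big_distrr -mulnA leq_mul2l; apply/orP; right.
  by apply: sum_line_set => t; rewrite inE => /andP[/tuples_inP].
have [g Gg nZ] : exists2 g, g \in G & g \notin 'Z(G).
  by apply/subsetPn; apply: contra nabG => sGZ; apply: abelianS sGZ (center_abelian G).
have leC : #|tuples_in :\: P| <= #|P|.
  have inj : injective (fun t : {ffun 'I_k -> gT} => update t i0 (t i0 * g)).
    move=> t u e; have e0 : t i0 = u i0.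
      have := congr1 (fun t : {ffun 'I_k -> gT} => t i0) e.
      by rewrite /= !update_eq; apply: mulIg.
    by rewrite -(update_id t i0) -(update_id u i0) -e0 -(update_update t i0 (t i0 * g)) e
      update_update.
  rewrite -(card_imset _ inj); apply/subset_leq_card/subsetP=> _ /imsetP[t tP ->].
  move: tP; rewrite !in_setD inE => /andP[+ tG]; rewrite tG /= negbK => Zt.
  rewrite inE update_eq groupMl // nZ andbT; apply/tuples_inP => l; rewrite ffunE.
  by case: eqP => _; rewrite ?groupM //; move/tuples_inP: tG.
rewrite -(cardsID P tuples_in) (setIidPr _); last by apply/subsetP=> t; rewrite inE => /andP[].
by lia.
Qed.

(* The coordinates are exchanged in the order 2, 3, ..., k - 1, 0, 1, so that the
   pair (0, 1) of [t] or the pair (2, 3) of [u] generates at every stage. *)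
Definition rank l : nat := (if l < 2 then l + k - 2 else l - 2)%N.

Definition interpolate n t u : {ffun 'I_k -> gT} := [ffun l => if rank l < n then u l else t l].

Lemma rank_surj n : n < k -> exists l, rank l = n.
Proof.
move=> nk; have [lt|ge] := ltnP n (k - 2).
  have h : n + 2 < k by lia.
  by exists (Ordinal h); rewrite /rank /=; case: ifP; lia.
have h : n + 2 - k < k by lia.
by exists (Ordinal h); rewrite /rank /=; case: ifP; lia.
Qed.

Lemma rank_inj : injective rank.
Proof.
move=> l l' e; apply/val_inj => /=; have := ltn_ord l; have := ltn_ord l'; move: e.
by rewrite /rank; do 2 case: ifP; lia.
Qed.

Lemma interpolateS n t u l : rank l = n ->
  interpolate n.+1 t u = update (interpolate n t u) l (u l).
Proof.
move=> e; apply/ffunP=> l'; rewrite !ffunE; have [->|ne] := eqVneq l' l; first by rewrite e ltnSn.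
by rewrite ltnS leq_eqVlt -e (inj_eq rank_inj) (negPf ne).
Qed.

Lemma interpolate_redundant n t u l : rank l = n -> t \in core G i0 i1 -> u \in core G i2 i3 ->
  redundant_at G l (interpolate n t u).
Proof.
rewrite inE => e /andP[Vt /eqP ct]; rewrite inE => /andP[Vu /eqP cu].
have aG : interpolate n t u \in tuples_in.
  apply/tuples_inP=> l'; rewrite ffunE; case: ifP => _;
    [exact: generating_mem Vu | exact: generating_mem Vt].
have lk := ltn_ord l; have k3 := k_gt3.
have p0 : rank i0 = (k - 2)%N by rewrite /rank /= add0n.
have p1 : rank i1 = (k - 1)%N by rewrite /rank /=; lia.
have [p2 p3] : rank i2 = 0 /\ rank i3 = 1%N by [].
have [l2|l2] := ltnP l 2.
  have nE : n = (l + k - 2)%N by rewrite -e /rank l2.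
  apply: (pair_redundant (i := i2) (j := i3) aG).
  - rewrite !ffunE p2 p3 (_ : 0 < n); last by lia.
    by rewrite (_ : 1 < n) //; lia.
  - by rewrite -val_eqE /=; lia.
  by rewrite -val_eqE /=; lia.
have nE : n = (l - 2)%N by rewrite -e /rank ltnNge l2.
apply: (pair_redundant (i := i0) (j := i1) aG).
- rewrite !ffunE p0 p1 (_ : (k - 2 < n) = false); last by lia.
  by rewrite (_ : (k - 1 < n) = false) //; lia.
- by rewrite -val_eqE /=; lia.
by rewrite -val_eqE /=; lia.
Qed.

Definition exits Y n := [set q : {ffun 'I_k -> gT} * {ffun 'I_k -> gT} |
  [&& q.1 \in Y :&: core G i0 i1, q.2 \in (V :\: Y) :&: core G i2 i3,
      interpolate n q.1 q.2 \in Y & interpolate n.+1 q.1 q.2 \notin Y]].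

(** Step [n] of the path from [t] to [u] is the crossing pair formed by the interpolated tuple and
    [u l]. The entries it forgets are kept by the opposite interpolation [interpolate n u t], whose
    entry [l] only repeats [u l] and can store an arbitrary [y] instead. So (t, u, y) can be
    recovered, and no crossing pair serves more than |G^k|/|G| paths. *)
Lemma card_exits Y n : Y \subset V -> n < k ->
  #|exits Y n| <= line_const * #|bd Y| * #|tuples_in|.
Proof.
move=> sYV nk; have [l pl] := rank_surj nk.
rewrite -(leq_pmul2r (cardG_gt0 G)) -cardsX.
pose cr := [set q : {ffun 'I_k -> gT} * gT |
  [&& q.1 \in Y, redundant_at G l q.1 & q.2 \in G :\: line_set G Y q.1 l]].
have crE : #|cr| = crossing G Y l.
  rewrite /crossing (eq_bigr (fun t => \sum_(x in G :\: line_set G Y t l) 1)); last first.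
    by move=> t _; rewrite sum1_card.
  rewrite pair_big_dep /= sum1dep_card; apply: eq_card => q; rewrite !inE.
  by rewrite andbA.
apply: (@leq_trans (#|cr| * #|tuples_in|)); last first.
  rewrite crE mulnAC leq_mul2r; apply/orP; right.
  by rewrite mulnAC; apply: crossing_le.
pose f (q : ({ffun 'I_k -> gT} * {ffun 'I_k -> gT}) * gT) :=
  (interpolate n q.1.1 q.1.2, q.1.2 l, update (interpolate n q.1.2 q.1.1) l q.2).
rewrite -cardsX -(card_in_imset (f := f)).
  apply/subset_leq_card/subsetP=> _ /imsetP[[[t u] y] + ->].
  case/setXP; rewrite in_set /= => /and4P[/setIP[Yt ct] /setIP[/setDP[Vu nYu] cu] Ym nYm] Gy.
  have Vt := subsetP sYV t Yt; have uG l' := generating_mem l' Vu.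
  have tG l' := generating_mem l' Vt.
  apply/setXP; split; last first.
    apply/tuples_inP=> l'; rewrite /= ffunE; case: eqP => // _; rewrite ffunE.
    by case: ifP.
  by rewrite in_set /= Ym (interpolate_redundant pl) // !inE uG -interpolateS // nYm.
move=> [[t u] y] [[t' u'] y'] _ _ [e1 e2 e3].
have ey : y = y'.
  by have := congr1 (fun t : {ffun 'I_k -> gT} => t l) e3; rewrite /= !update_eq.
have E1 l' : interpolate n t u l' = interpolate n t' u' l' by rewrite e1.
have E3 l' : l' != l -> interpolate n u t l' = interpolate n u' t' l'.
  by move=> nl; have := congr1 (fun t : {ffun 'I_k -> gT} => t l') e3; rewrite /= !update_neq.
have et : t = t'.
  apply/ffunP=> l'; have := E1 l'; rewrite !ffunE; case: ifP => // lt _.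
  have nl : l' != l by apply: contraTneq lt => ->; rewrite pl ltnn.
  by have := E3 _ nl; rewrite !ffunE lt.
have eu : u = u'.
  apply/ffunP=> l'; have := E1 l'; rewrite !ffunE; case: ifP => // lt _.
  have [->//|nl] := eqVneq l' l.
  by have := E3 _ nl; rewrite !ffunE lt.
by rewrite ey et eu.
Qed.

(** A path from [Y] to its complement has a first step out of [Y], one of [k]. *)
Lemma core_product_le Y : Y \subset V ->
  #|Y :&: core G i0 i1| * #|(V :\: Y) :&: core G i2 i3| <=
    k * (line_const * #|bd Y| * #|tuples_in|).
Proof.
move=> sYV; rewrite -cardsX.
apply: leq_trans (_ : #|\bigcup_(n in [set: 'I_k]) exits Y n| <= _); last first.
  apply: leq_trans (card_bigcup_le _ (n := (line_const * #|bd Y| * #|tuples_in|)%N) _) _ => [n|].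
    by apply: card_exits.
  by rewrite cardsT card_ord.
apply/subset_leq_card/subsetP=> -[t u]; rewrite in_setX /= => /andP[tP uP].
have m0 : interpolate 0 t u = t by apply/ffunP=> l; rewrite ffunE.
have mk : interpolate k t u = u.
  apply/ffunP=> l; rewrite ffunE (_ : rank l < k) //.
  by have := ltn_ord l; rewrite /rank; case: ifP; lia.
have Yt : t \in Y by case/setIP: tP.
have nYu : u \notin Y by case/setIP: uP => /setDP[].
have ex : exists n, interpolate n t u \notin Y by exists k; rewrite mk.
case: (ex_minnP ex) => -[|n] nY min; first by rewrite m0 Yt in nY.
have nk : n < k by apply: min; rewrite mk.
apply/bigcupP; exists (Ordinal nk); first by rewrite inE.
rewrite in_set; apply/and4P; split=> //.
by apply: contraT => /min; rewrite ltnn.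
Qed.

Definition expansion_const :=
  (core_const * core_const * (degree.*2.+1 + k * line_const) * (4 * N2))%N.

(** [Y] is compared with its part in the core of (0, 1), the complement with its part in the core of
    (2, 3). The two pairs are disjoint, as the interpolation requires. *)
Theorem product_replacement_isoperimetry Y : Y \subset V -> 2 * #|Y| < #|V| ->
  #|Y| <= expansion_const * #|bd Y|.
Proof.
move=> sYV ltY; pose Y' := V :\: Y.
have sY'V : Y' \subset V by apply: subsetDl.
have cV : #|Y| + #|Y'| = #|V| by rewrite -(cardsID Y V) (setIidPr sYV).
have h1 := card_le_core sYV (isT : i0 != i1).
have h2 := card_le_core sY'V (isT : i2 != i3).
have h3 := boundary_compl_le sYV; have h4 := core_product_le sYV.
have h5 := card_tuples_in.
have leW (A : {set {ffun 'I_k -> gT}}) : A \subset V -> #|A| <= #|tuples_in|.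
  by move=> sA; apply: subset_leq_card; apply: subset_trans sA generating_tuples_in.
have w1 : #|Y :&: core G i0 i1| <= #|tuples_in| by apply/leW/(subset_trans _ sYV)/subsetIl.
have w2 : #|Y' :&: core G i2 i3| <= #|tuples_in| by apply/leW/(subset_trans _ sY'V)/subsetIl.
have w3 : #|bd Y| <= #|tuples_in|.
  apply: leW; apply/subsetP=> t; rewrite inE => /andP[/setDP[]//].
rewrite -/Y' in h3 h4.
move: #|bd Y| #|bd Y'| #|Y :&: _| #|Y' :&: _| #|tuples_in| w1 w2 w3 h1 h2 h3 h4 h5
  => D D' a b W w1 w2 w3 h1 h2 h3 h4 h5.
have lt : #|Y| < #|Y'| by lia.
rewrite -cV in h5; apply: (isoperimetry_arith lt h1 h2 h3 _ h5 w1 w2 w3).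
by apply: leq_trans h4 _; rewrite !mulnA.
Qed.

End Expansion.

(** * Subgroups with abelian centralizers *)

Section CentralizerPartition.
Local Open Scope group_scope.
Variables (gT : finGroupType) (H Z : {group gT}).
Hypotheses (sZH : Z \subset H) (cZH : Z \subset 'C(H)).
Hypothesis centH : {in H :\: Z, forall x, abelian 'C_H[x]}.
Hypothesis normH :
  {in H :\: Z, forall x, #|'N_H('C_H[x]) : 'C_H[x]| <= 2}.

(** Off [Z], commuting is an equivalence relation because centralizers are abelian; the sets C_H[x]
    minus [Z] are its classes and partition H minus Z. *)
Lemma subcent1_eq x y :
  x \in H :\: Z -> y \in 'C_H[x] :\: Z -> 'C_H[y] = 'C_H[x].
Proof.
move=> Hx /setDP[Cy nZy]; have Hy : y \in H :\: Z.
  by rewrite inE nZy; case/setIP: Cy.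
have sub u v : v \in H :\: Z -> u \in 'C_H[v] -> 'C_H[v] \subset 'C_H[u].
  move=> Hv Cu; rewrite subsetI subsetIl sub_cent1.
  exact: (subsetP (centH Hv)).
apply/eqP; rewrite eqEsubset !sub //.
have /setIP[_ /cent1P cxy] := Cy.
by rewrite inE; apply/andP; split; [case/setDP: Hx | apply/cent1P].
Qed.

Lemma mem_subcent1_id x : x \in H :\: Z -> x \in 'C_H[x] :\: Z.
Proof. by case/setDP=> Hx nZx; rewrite inE nZx inE Hx cent1id. Qed.

Lemma sub_subcent1_center x : x \in H -> Z \subset 'C_H[x].
Proof.
by move=> Hx; rewrite subsetI sZH sub_cent1; apply: (subsetP _ x Hx); rewrite centsC.
Qed.

Lemma center_memJ y g : g \in H -> (y ^ g \in Z) = (y \in Z).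
Proof.
by move=> Hg; rewrite memJ_norm //; apply: (subsetP (cents_norm _)) Hg; rewrite centsC.
Qed.

Lemma subcent1_conj x g : g \in H -> 'C_H[x ^ g] = 'C_H[x] :^ g.
Proof. by move=> Hg; rewrite conjIg conjGid // cent1J. Qed.

Definition cent_block x := class_support ('C_H[x] :\: Z) H.

Lemma cent_block_TI x : x \in H :\: Z ->
  normedTI ('C_H[x] :\: Z) H 'N_H('C_H[x]).
Proof.
move=> Hx; apply/normedTI_memJ_P; split; last first.
- move=> a g Ca Hg; have HaZ : a \in H :\: Z.
    by case/setDP: Ca => /setIP[? ?] nZ; rewrite inE nZ.
  rewrite inE (center_memJ _ Hg); case/setDP: (Ca) => _ -> /=.
  rewrite [g \in _]inE Hg /=; apply/idP/idP => [Cag | /normP <-]; last first.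
    by rewrite memJ_conjg; case/setDP: Ca.
  apply/normP; rewrite -{1}(subcent1_eq Hx Ca) -subcent1_conj //.
  apply: subcent1_eq => //; rewrite inE Cag center_memJ // andbT.
  by case/setDP: Ca.
- exact: subsetIl.
by apply/set0Pn; exists x; apply: mem_subcent1_id.
Qed.

Lemma cent_block_disjoint x y : x \in H :\: Z -> y \in H :\: Z ->
  y \notin cent_block x -> [disjoint cent_block x & cent_block y].
Proof.
move=> Hx Hy; apply: contraNT => /pred0Pn[_ /andP[/= /imset2P[a g Ca Hg ->]]].
case/imset2P=> b h Cb Hh eqab.
have Hgh : h * g^-1 \in H by rewrite groupM ?groupV.
have [Hy1 nZy] := setDP Hy.
apply/imset2P; exists (y ^ (h * g^-1)) (h * g^-1)^-1; rewrite ?groupV ?conjgK //.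
rewrite inE center_memJ // nZy -(subcent1_eq Hx Ca) -(memJ_conjg _ g) conjgM conjgKV.
rewrite -subcent1_conj // eqab subcent1_conj // memJ_conjg (subcent1_eq Hy Cb).
by case/setDP: (mem_subcent1_id Hy).
Qed.

(** [c] is the index of [Z] in the centralizer, [n] the number of conjugates of the centralizer, and
    [e] its index in its normalizer. *)
Lemma cent_block_card x : x \in H :\: Z ->
  exists c n e, [/\ #|'C_H[x]| = (c * #|Z|)%N, #|H| = (n * (e * (c * #|Z|)))%N,
    #|cent_block x| = (n * (c.-1 * #|Z|))%N, (1 < c)%N &
    e = 1%N \/ e = 2%N] /\ ((0 < n)%N /\ (n = 1%N -> H \subset 'N('C_H[x]))).
Proof.
move=> Hx; have [Hx1 nZx] := setDP Hx.
have sZC := sub_subcent1_center Hx1.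
have cE : (#|'C_H[x]| = #|'C_H[x] : Z| * #|Z|)%N by rewrite mulnC Lagrange.
have sCN : 'C_H[x] \subset 'N_H('C_H[x]) by rewrite subsetI subsetIl normG.
exists #|'C_H[x] : Z|, #|H : 'N_H('C_H[x])|, #|'N_H('C_H[x]) : 'C_H[x]|.
split; [split=> // | split=> //].
- by rewrite -cE mulnC [(#|_ : _| * #|'C_H[x]|)%N]mulnC !Lagrange // subsetIl.
- rewrite (card_support_normedTI (cent_block_TI Hx)) mulnC cardsD.
  by rewrite (setIidPr sZC) {1}cE -{2}[#|Z|]mul1n -mulnBl subn1.
- rewrite indexg_gt1; apply: contra nZx => /subsetP; apply.
  by case/setDP: (mem_subcent1_id Hx).
- have := normH Hx; have: (0 < #|'N_H('C_H[x]) : 'C_H[x]|)%N by apply: indexg_gt0.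
  by case: (#|_ : _|) => [|[|[|]]] //; [left | right].
by move/eqP; rewrite indexg_eq1 => /subset_trans; apply; apply: subsetIr.
Qed.

(* The class equation of [H / Z]: the cosets outside the trivial one are
   partitioned by the conjugates of centralizers; a block with centralizer of
   order [c] and [n] conjugates contributes [n * (c - 1)], where
   [#|H / Z| = e * n * c] with [e <= 2]. *)
Lemma centralizer_trichotomy x : x \in H :\: Z ->
    (4 * #|Z| <= #|'C_H[x]|)%N ->
  [\/ H \subset 'N('C_H[x]),
      #|'C_H[x]| = (4 * #|Z|)%N /\ #|H| = (24 * #|Z|)%N |
      #|'C_H[x]| = (5 * #|Z|)%N /\ #|H| = (60 * #|Z|)%N].
Proof.
move=> Hx le4C; have zgt0 : (0 < #|Z|)%N by rewrite cardG_gt0.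
pose h := #|H : Z|; have hE : #|H| = (h * #|Z|)%N by rewrite mulnC Lagrange.
pose full (U : {set gT}) := #|U| == (h.-1 * #|Z|)%N.
have next (U : {set gT}) : U \subset H :\: Z ->
    ~~ full U -> exists2 y, y \in H :\: Z & y \notin U.
  move=> sU nfull; suff /properP[_ [y]] : U \proper H :\: Z by exists y.
  rewrite properEcard sU ltn_neqAle subset_leq_card // andbT.
  apply: contra nfull; rewrite /full => /eqP ->; rewrite cardsD (setIidPr sZH) hE.
  by rewrite -{2}[#|Z|]mul1n -mulnBl subn1.
have blockS y : y \in H :\: Z -> cent_block y \subset H :\: Z.
  move=> Hy; apply/subsetP=> _ /imset2P[a g Ca Hg ->].
  case/setDP: Ca => /setIP[Ha _] nZa.
  by rewrite inE center_memJ // nZa groupJ.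
have maxU (U : {set gT}) : U \subset H :\: Z -> (#|U| <= h.-1 * #|Z|)%N.
  move/subset_leq_card; rewrite cardsD (setIidPr sZH) hE.
  by rewrite -{2}[#|Z|]mul1n -mulnBl subn1.
pose vals (c n e v : nat) := [/\ h = n * (e * c), v = n * c.-1, 1 < c, 0 < n &
    e = 1 \/ e = 2]%N.
have val y : y \in H :\: Z -> exists c n e v, vals c n e v /\
    [/\ #|cent_block y| = (v * #|Z|)%N, #|'C_H[y]| = (c * #|Z|)%N &
      n = 1%N -> H \subset 'N('C_H[y])].
  move=> Hy; have [c [n [e [[cE HE bE c1 e12] [n0 n1]]]]] := cent_block_card Hy.
  exists c, n, e, (n * c.-1)%N; split; last by rewrite bE mulnA.
  split=> //; apply/eqP; rewrite -(eqn_pmul2r zgt0) -hE HE; apply/eqP; lia.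
have add (U : {set gT}) y v u : U \subset H :\: Z -> y \in H :\: Z ->
    [disjoint U & cent_block y] -> #|U| = (u * #|Z|)%N ->
    #|cent_block y| = (v * #|Z|)%N ->
    #|U :|: cent_block y| = ((u + v) * #|Z|)%N.
  move=> sU Hy dis uE vE; rewrite cardsU (disjoint_setI0 dis) cards0 subn0 uE vE.
  by rewrite mulnDl.
have Ufull (U : {set gT}) u : #|U| = (u * #|Z|)%N -> full U = (u == h.-1).
  by move=> uE; rewrite /full uE eqn_pmul2r.
have Umax (U : {set gT}) u : U \subset H :\: Z -> #|U| = (u * #|Z|)%N -> (u <= h.-1)%N.
  by move=> /maxU le uE; rewrite uE leq_pmul2r // in le.
(* Splitting on small [c] and on [e] removes the products of unknowns, so that the comparison of
   several blocks becomes linear arithmetic. *)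
have shape c n e v : vals c n e v -> (0 < n)%N /\
    ([\/ h = 2 * n /\ v = n, h = 3 * n /\ v = 2 * n | 4 * n <= h /\ h = v + n] \/
     [\/ h = 4 * n /\ v = n, h = 6 * n /\ v = 2 * n |
         8 * n <= h /\ h = 2 * v + 2 * n])%N.
  case=> -> -> c1 n0 e12; split=> //.
  have [c2|[c3|c4]] : (c = 2 \/ c = 3 \/ 4 <= c)%N by lia.
  - by subst c; case: e12 => ->; [left|right]; constructor 1; split; lia.
  - by subst c; case: e12 => ->; [left|right]; constructor 2; split; lia.
  by case: e12 => ->; [left|right]; constructor 3; split; nia.
have shape4 c n e v : vals c n e v -> (4 <= c)%N ->
    ([\/ [/\ c = 4, h = 4 * n & v = 3 * n], [/\ c = 5, h = 5 * n & v = 4 * n] |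
        6 * n <= h /\ h = v + n] \/
     [\/ [/\ c = 4, h = 8 * n & v = 3 * n], [/\ c = 5, h = 10 * n & v = 4 * n] |
        12 * n <= h /\ h = 2 * v + 2 * n])%N.
  case=> -> -> _ n0 e12 c4.
  have [c2|[c3|{}c4]] : (c = 4 \/ c = 5 \/ 6 <= c)%N by lia.
  - by subst c; case: e12 => ->; [left|right]; constructor 1; split; lia.
  - by subst c; case: e12 => ->; [left|right]; constructor 2; split; lia.
  by case: e12 => ->; [left|right]; constructor 3; split; nia.
have [c1 [n1 [e1 [v1 [V1 [b1 line_const N1]]]]]] := val x Hx.
have c1ge4 : (4 <= c1)%N by rewrite line_const leq_pmul2r // in le4C.
rewrite line_const hE; have s1 := blockS x Hx.
suff: (n1 = 1 \/ (c1 = 4 /\ h = 24) \/ (c1 = 5 /\ h = 60))%N.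
  by case=> [/N1|[[-> ->]|[-> ->]]]; [constructor 1|constructor 2|constructor 3].
(* A single block: h - 1 = n (c - 1) and h = n e c force e = n = 1. *)
have [f1|/(next _ s1)[y2 Hy2 ny2]] := boolP (full (cent_block x)).
  move: f1; rewrite (Ufull _ _ b1) => /eqP f1.
  case: V1 => hE1 vE1 _ n0 [] e; subst e1; [left; nia| nia].
have d2 := cent_block_disjoint Hx Hy2 ny2.
have [c2 [n2 [e2 [v2 [V2 [b2 C2 _]]]]]] := val y2 Hy2.
have b12 := add _ _ _ _ s1 Hy2 d2 b1 b2.
have s12 : cent_block x :|: cent_block y2 \subset H :\: Z by rewrite subUset s1 blockS.
have m12 := Umax _ _ s12 b12; have m1 := Umax _ _ s1 b1.
have S1 := shape _ _ _ _ V1; have S2 := shape _ _ _ _ V2.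
have V1' := shape4 _ _ _ _ V1 c1ge4.
have {}S1 := proj1 S1.
(* Two blocks: only the dihedral solution is left, with [e1 = 2], [n1 = 1], [c2 = 2] and
   [e2 = 1]. *)
have [f2|/(next _ s12)[y3 Hy3 ny3]] := boolP (full (cent_block x :|: cent_block y2)).
  move: f2; rewrite (Ufull _ _ b12) => /eqP f2; clearbody h; clear -S1 S2 V1' f2 m1.
  case: V1' => [] []; case; try (move=> e41); try move=> e42; try move=> e43;
  case: S2 => S20 [] [] [e21 e22]; lia.
(* Any block has at least h/4 cosets and the first, with c at least 4, at least 3h/8, so a fourth
   block does not fit. *)
have weak c n e v : vals c n e v -> (h <= 4 * v)%N.
  by move/shape=> S; clear -S; case: S => _ [] [] [e21 e22]; lia.
have d3 : [disjoint cent_block x :|: cent_block y2 & cent_block y3].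
  rewrite disjoints_subset subUset -!disjoints_subset.
  by move: ny3; rewrite inE negb_or => /andP[? ?]; rewrite !cent_block_disjoint.
have [c3 [n3 [e3 [v3 [V3 [b3 C3 _]]]]]] := val y3 Hy3.
have b123 := add _ _ _ _ s12 Hy3 d3 b12 b3.
have s123 : cent_block x :|: cent_block y2 :|: cent_block y3 \subset H :\: Z.
  by rewrite subUset s12 blockS.
have m123 := Umax _ _ s123 b123; have S3 := shape _ _ _ _ V3.
(* Three blocks: size forces all [e] to be 2, and then 1/c1 + 1/c2 + 1/c3 = 1 + 2/h. With c1 at
   least 4 the other two are 2, 2 (then [n1 = 1]) or 2, 3, where c1 = 4 gives h = 24 and c1 = 5
   gives h = 60. *)
have [f3|/(next _ s123)[y4 Hy4 ny4]] :=
  boolP (full (cent_block x :|: cent_block y2 :|: cent_block y3)).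
  move: f3; rewrite (Ufull _ _ b123) => /eqP f3; clearbody h; clear -S1 S2 S3 V1' f3 m1.
  case: V1' => [] []; case; try (move=> e41); try move=> e42; try move=> e43;
  case: S2 => S20 [] [] [e21 e22]; try lia;
  case: S3 => S30 [] [] [e31 e32]; lia.
have d4 : [disjoint cent_block x :|: cent_block y2 :|: cent_block y3 & cent_block y4].
  rewrite disjoints_subset !subUset -!disjoints_subset.
  by move: ny4; rewrite !inE !negb_or => /andP[/andP[? ?] ?]; rewrite !cent_block_disjoint.
have [c4 [n4 [e4 [v4 [V4 [b4 C4 _]]]]]] := val y4 Hy4.
have b1234 := add _ _ _ _ s123 Hy4 d4 b123 b4.
have m1234 := Umax _ _ _ b1234; rewrite subUset s123 blockS // in m1234.
have {m1234} m1234 := m1234 isT.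
have W2 := weak _ _ _ _ V2; have W3 := weak _ _ _ _ V3; have W4 := weak _ _ _ _ V4.
clear -S1 V1' W2 W3 W4 m1234.
by case: V1' => [] []; case; try (move=> e41); try move=> e42; try move=> e43; lia.
Qed.

End CentralizerPartition.

Local Open Scope ring_scope.

(** * Two by two matrices *)

Section Matrix2.
Variable F : fieldType.
Implicit Types A B C : 'M[F]_2.

Lemma mulmx2E A B i j : (A *m B) i j = A i 0 * B 0 j + A i 1 * B 1 j.
Proof. by rewrite mxE !big_ord_recl big_ord0 addr0 (_ : lift _ _ = 1) //; apply: val_inj. Qed.

Lemma mxtrace2 A : \tr A = A 0 0 + A 1 1.
Proof. by rewrite /mxtrace !big_ord_recl big_ord0 addr0 (_ : lift _ _ = 1) //;
  apply: val_inj. Qed.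

Lemma matrix2P A B :
  A 0 0 = B 0 0 -> A 0 1 = B 0 1 -> A 1 0 = B 1 0 -> A 1 1 = B 1 1 -> A = B.
Proof.
move=> e00 e01 e10 e11; apply/matrixP=> i j.
have o2 (k : 'I_2) : k = 0 \/ k = 1.
  by case: k => [[|[|]]] // ?; [left | right]; apply: val_inj.
by have [-> | ->] := o2 i; have [-> | ->] := o2 j.
Qed.

Lemma det_mx2 A : \det A = A 0 0 * A 1 1 - A 0 1 * A 1 0.
Proof.
have e1 : lift 0 0 = 1 :> 'I_2 by apply: val_inj.
have e0 : lift 1 0 = 0 :> 'I_2 by apply: val_inj.
rewrite (expand_det_row _ 0) !big_ord_recl big_ord0 addr0 e1 /cofactor !det_mx11.
by rewrite !mxE e1 e0 /=; ring.
Qed.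

Lemma cayley_hamilton2 A : A *m A = \tr A *: A - (\det A)%:M.
Proof.
by apply: matrix2P; rewrite mulmx2E !mxE mxtrace2 det_mx2 /=; ring.
Qed.

Definition nonscalar A := [|| A 0 1 != 0, A 1 0 != 0 | A 0 0 != A 1 1].

Lemma nonscalarPn A : reflect (A = (A 0 0)%:M) (~~ nonscalar A).
Proof.
rewrite !negb_or !negbK; apply: (iffP and3P) => [[/eqP e1 /eqP e2 /eqP e3] | ->].
  by apply: matrix2P; rewrite !mxE ?mulr1n.
by rewrite !mxE.
Qed.

(** Lets [ring] or [field] check that an equation follows from another one with cofactor [k]. *)
Lemma lincomb1 (k u v x y : F) : x - y = k * (u - v) -> u = v -> x = y.
Proof. by move=> e uv; apply/eqP; rewrite -subr_eq0 e uv subrr mulr0. Qed.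

Lemma commute_nonscalar A B : nonscalar A -> A *m B = B *m A ->
  exists a b, B = a%:M + b *: A.
Proof.
move=> nsA AB; have e i j := congr1 (fun M : 'M_2 => M i j) AB.
have := (e 0 0, e 0 1, e 1 0, e 1 1); rewrite /= !mulmx2E => -[[[e00 e01] e10] e11].
case/or3P: nsA => nz.
- exists (B 0 0 - B 0 1 / A 0 1 * A 0 0), (B 0 1 / A 0 1).
  apply: matrix2P; rewrite !mxE /= ?mulr1n ?mulr0n ?add0r; try by field.
  + apply: (mulfI nz); rewrite (_ : _ * (_ * _) = B 0 1 * A 1 0); last by field.
    by apply: (lincomb1 (k := 1) _ e00); ring.
  + apply: (mulfI nz); apply: (lincomb1 (k := 1) _ e01); by field.
- exists (B 0 0 - B 1 0 / A 1 0 * A 0 0), (B 1 0 / A 1 0).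
  apply: matrix2P; rewrite !mxE /= ?mulr1n ?mulr0n ?add0r; try by field.
  + apply: (mulfI nz); apply: (lincomb1 (k := (-1)) _ e00); by field.
  + apply: (mulfI nz); apply: (lincomb1 (k := (-1)) _ e10); by field.
have nz' : A 0 0 - A 1 1 != 0 by rewrite subr_eq0.
exists (B 0 0 - (B 0 0 - B 1 1) / (A 0 0 - A 1 1) * A 0 0), ((B 0 0 - B 1 1) / (A 0 0 - A 1 1)).
apply: matrix2P; rewrite !mxE /= ?mulr1n ?mulr0n ?add0r; try by field.
+ apply: (mulfI nz'); apply: (lincomb1 (k := 1) _ e01); by field.
+ apply: (mulfI nz'); apply: (lincomb1 (k := (-1)) _ e10); by field.
Qed.
Lemma span_commute A a b c d :
  (a%:M + b *: A) *m (c%:M + d *: A) = (c%:M + d *: A) *m (a%:M + b *: A).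
Proof. by apply: matrix2P; rewrite !mulmx2E !mxE /=; ring. Qed.

Implicit Types v w : 'rV[F]_2.

(* [1 + s v^perp v], where [v^perp] is the column [(- v_1, v_0)^T] killed by [v]. *)
Definition transvec v s : 'M[F]_2 :=
  \matrix_(i, j) ((i == j)%:R + s * (if i == 0 then - v 0 1 else v 0 0) * v 0 j).

Lemma transvecE v s i j : transvec v s i j =
  (i == j)%:R + s * (if i == 0 then - v 0 1 else v 0 0) * v 0 j.
Proof. by rewrite mxE. Qed.

Lemma det_transvec v s : \det (transvec v s) = 1.
Proof. by rewrite det_mx2 !mxE /=; ring. Qed.

Lemma transvecD v s t : transvec v s *m transvec v t = transvec v (s + t).
Proof. by apply: matrix2P; rewrite mulmx2E !mxE /=; ring. Qed.

Lemma transvec0 v : transvec v 0 = 1%:M.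
Proof. by apply: matrix2P; rewrite !mxE /=; ring. Qed.

Definition cross v w := v 0 0 * w 0 1 - v 0 1 * w 0 0.

Lemma mul_rv2E v (A : 'M[F]_2) j : (v *m A) 0 j = v 0 0 * A 0 j + v 0 1 * A 1 j.
Proof.
by rewrite mxE !big_ord_recl big_ord0 addr0 (_ : lift _ _ = 1) //; apply: val_inj.
Qed.

Lemma rv2P v w : v 0 0 = w 0 0 -> v 0 1 = w 0 1 -> v = w.
Proof.
move=> e0 e1; apply/rowP=> -[[|[|]]] // i.
  by rewrite (_ : Ordinal i = 0) //; apply: val_inj.
by rewrite (_ : Ordinal i = 1) //; apply: val_inj.
Qed.

Lemma mul_transvec (x v : 'rV_2) s : x *m transvec v s = x + (s * cross v x) *: v.
Proof. by apply: rv2P; rewrite mul_rv2E !mxE /= /cross; ring. Qed.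

Lemma cross_vv v : cross v v = 0.
Proof. by rewrite /cross; ring. Qed.

Lemma crossC v w : cross v w = - cross w v.
Proof. by rewrite /cross; ring. Qed.

Lemma cross0l v : cross 0 v = 0.
Proof. by rewrite /cross !mxE; ring. Qed.

Lemma crossDr v w (x : 'rV_2) : cross v (w + x) = cross v w + cross v x.
Proof. by rewrite /cross !mxE; ring. Qed.

Lemma crossZr v k w : cross v (k *: w) = k * cross v w.
Proof. by rewrite /cross !mxE; ring. Qed.

Lemma cross_eq0 v w : v != 0 -> cross v w = 0 -> exists k, w = k *: v.
Proof.
move=> v0 vw; have [v00|v00] := eqVneq (v 0 0) 0.
  have v01: v 0 1 != 0 by apply: contra v0 => /eqP v01; apply/eqP/rv2P; rewrite mxE.
  exists (w 0 1 / v 0 1); apply: rv2P; rewrite !mxE ?divfK //.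
  move: vw; rewrite /cross v00 mul0r mulr0 sub0r => /eqP.
  by rewrite oppr_eq0 mulf_eq0 (negPf v01) => /eqP.
exists (w 0 0 / v 0 0); apply: rv2P; rewrite !mxE ?divfK //.
by apply: (mulfI v00); apply: (lincomb1 (k := 1) _ vw); rewrite /cross; field.
Qed.

Lemma transvec_mulC v s (A : 'M[F]_2) : \det A = 1 ->
  A *m transvec (v *m A) s = transvec v s *m A.
Proof.
rewrite det_mx2 => dA; pose w j := v 0 0 * A 0 j + v 0 1 * A 1 j.
apply: matrix2P; rewrite !mulmx2E !transvecE !mul_rv2E /=.
- by apply: (lincomb1 (k := - s * v 0 1 * w 0) _ dA); rewrite /w; ring.
- by apply: (lincomb1 (k := - s * v 0 1 * w 1) _ dA); rewrite /w; ring.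
- by apply: (lincomb1 (k := s * v 0 0 * w 0) _ dA); rewrite /w; ring.
- by apply: (lincomb1 (k := s * v 0 0 * w 1) _ dA); rewrite /w; ring.
Qed.

(** A nilpotent matrix is singular, and then det (A + 1) = 1 + tr A + det A kills the trace. *)
Lemma nilpotent2 A k : \det (A + 1) = 1 -> A ^+ k = 0 ->
  \det A = 0 /\ \tr A = 0.
Proof.
case: k => [|k] dA Ak; first by move/eqP: Ak; rewrite oner_eq0.
have d0 : \det A = 0.
  have := congr1 determinant Ak; rewrite det0.
  have -> : \det (A ^+ k.+1) = \det A ^+ k.+1.
    by elim: {Ak}k => // k IH; rewrite exprS det_mulmx IH -exprS.
  by move/eqP; rewrite expf_eq0 => /eqP.
split=> //; move: dA; rewrite !det_mx2 !mxE /= !addr0 => dA; move: d0; rewrite det_mx2 => d0.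
by rewrite mxtrace2 -[RHS](subrr 1) -{1}dA -[RHS]subr0 -d0; ring.
Qed.

(** A matrix of rank one is a column times a row; trace zero says that the row kills the column,
    which is the shape of [transvec]. A nonzero row of [A], up to scaling, serves as [v]. *)
Lemma nilpotent_transvec A : A != 0 -> \det A = 0 -> \tr A = 0 ->
  exists v s, [/\ v != 0, s != 0 & A + 1 = transvec v s].
Proof.
rewrite det_mx2 mxtrace2 => A0 dA /eqP; rewrite addr_eq0 => /eqP e00.
have [e10|e10] := eqVneq (A 1 0) 0.
  have e11 : A 1 1 = 0.
    move/eqP: dA; rewrite e00 e10 mulr0 subr0 mulNr oppr_eq0 mulf_eq0 orbb.
    by move/eqP.
  rewrite e11 oppr0 in e00.
  exists (\row_j (j == 1)%:R), (- A 0 1); split.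
  - by apply/eqP=> /rowP/(_ 1); rewrite !mxE => /eqP; rewrite oner_eq0.
  - apply: contra A0; rewrite oppr_eq0 => /eqP e01; apply/eqP/matrix2P; rewrite ?mxE //.
  - by apply: matrix2P; rewrite !mxE /= ?e00 ?e11 ?e10; ring.
exists (row 1 A), (A 1 0)^-1; split; rewrite ?invr_eq0 //.
  by apply: contra e10 => /eqP/rowP/(_ 0); rewrite !mxE => ->.
apply: matrix2P; rewrite !transvecE !mxE /= ?e00; try by field.
apply: (mulfI e10); apply: (lincomb1 (k := -1) _ dA); rewrite e00; field.
exact: e10.
Qed.

Lemma cross_mul v w (A : 'M[F]_2) :
  cross (v *m A) (w *m A) = \det A * cross v w.
Proof. by rewrite /cross !mul_rv2E det_mx2; ring. Qed.

Lemma cross_decomp v w (x : 'rV_2) : cross v w != 0 ->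
  x = (cross x w / cross v w) *: v + (cross v x / cross v w) *: w.
Proof. by move=> D; apply: rv2P; rewrite !mxE; move: D; rewrite /cross => D; field. Qed.

Lemma matrix2_rv v w (A B : 'M[F]_2) : cross v w != 0 ->
  v *m A = v *m B -> w *m A = w *m B -> A = B.
Proof.
move=> D eA eB; apply/row_matrixP=> i; rewrite !rowE.
by rewrite (cross_decomp (delta_mx 0 i) D) !mulmxDl -!scalemxAl eA eB.
Qed.

(** The big Bruhat cell: in the basis [v], [w], a matrix of determinant 1 with nonzero corner [b] is
    a product of three unipotent triangular factors. *)
Lemma SL2_decomp v w (A : 'M[F]_2) : cross v w != 0 -> \det A = 1 ->
  cross v (v *m A) != 0 ->
  exists a b c, A = transvec v a *m transvec w b *m transvec v c.
Proof.
move=> D0 dA b0; set D := cross v w in D0 *.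
pose a := cross (v *m A) w / D; pose b := cross v (v *m A) / D.
pose c := cross (w *m A) w / D; pose d := cross v (w *m A) / D.
have vA : v *m A = a *: v + b *: w by apply: cross_decomp.
have wA : w *m A = c *: v + d *: w by apply: cross_decomp.
have bn0 : b != 0 by rewrite mulf_neq0 ?invr_eq0.
have ad : a * d - b * c = 1.
  have := cross_mul v w A; rewrite dA mul1r vA wA.
  have -> : cross (a *: v + b *: w) (c *: v + d *: w) = (a * d - b * c) * D.
    by rewrite /D /cross !mxE; ring.
  by move/eqP; rewrite -[X in _ == X]mul1r (inj_eq (mulIf D0)) => /eqP.
exists ((d - 1) / b / D), (- b / D), ((a - 1) / b / D).
have vv : cross v v = 0 by rewrite /cross; ring.
have ww : cross w w = 0 by rewrite /cross; ring.
have wv : cross w v = - D by rewrite /D /cross; ring.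
have {ad} ec : c = (a * d - 1) / b by rewrite -ad; field.
rewrite {}ec in wA; clearbody a b d; move: D0; rewrite /D /cross => D0.
apply: (matrix2_rv D0); first rewrite vA; last rewrite wA;
  rewrite 2!mulmxA !mul_transvec /cross; apply: rv2P; rewrite !mxE;
  by field; rewrite ?bn0 ?D0.
Qed.

Lemma cross_mulE v A :
  cross v (v *m A) = - (v 0 0 * v 0 1) * A 0 0 + v 0 0 ^+ 2 * A 0 1
    - v 0 1 ^+ 2 * A 1 0 + v 0 0 * v 0 1 * A 1 1.
Proof. by rewrite /cross !mul_rv2E; ring. Qed.

(** A matrix that preserves the lines of the two basis vectors and of their sum is scalar. *)
Lemma nonscalar_moves A : nonscalar A -> exists2 v : 'rV_2, v != 0 & cross v (v *m A) != 0.
Proof.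
have nz (v : 'rV[F]_2) i : v 0 i != 0 -> v != 0.
  by apply: contra => /eqP ->; rewrite mxE.
case/or3P=> h.
- exists (\row_j (j == 0)%:R); first by apply: (nz _ 0); rewrite mxE oner_eq0.
  by rewrite /cross !mul_rv2E !mxE /= !mul1r !mul0r addr0 subr0.
- exists (\row_j (j == 1)%:R); first by apply: (nz _ 1); rewrite mxE oner_eq0.
  by rewrite /cross !mul_rv2E !mxE /= !mul1r !mul0r !add0r oppr_eq0.
have [e01|] := eqVneq (A 0 1) 0; last first.
  exists (\row_j (j == 0)%:R); first by apply: (nz _ 0); rewrite mxE oner_eq0.
  by rewrite /cross !mul_rv2E !mxE /= !mul1r !mul0r addr0 subr0.
have [e10|] := eqVneq (A 1 0) 0; last first.
  exists (\row_j (j == 1)%:R); first by apply: (nz _ 1); rewrite mxE oner_eq0.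
  by rewrite /cross !mul_rv2E !mxE /= !mul1r !mul0r !add0r oppr_eq0.
exists (const_mx 1); first by apply: (nz _ 0); rewrite mxE oner_eq0.
by rewrite /cross !mul_rv2E !mxE /= !mul1r e01 e10 add0r addr0 subr_eq0 eq_sym.
Qed.

Lemma nonscalar_span A a b : nonscalar (a%:M + b *: A) = (b != 0) && nonscalar A.
Proof.
rewrite /nonscalar !mxE /= !add0r !mulf_eq0 !negb_or.
have -> : (a + b * A 0 0 != a + b * A 1 1) = (b != 0) && (A 0 0 != A 1 1).
  by rewrite (inj_eq (addrI a)) -subr_eq0 -mulrBr mulf_eq0 negb_or subr_eq0.
by rewrite -!andb_orr.
Qed.

Lemma double_root_sqr0 A e : \tr A = e *+ 2 -> \det A = e ^+ 2 ->
  (A - e%:M) *m (A - e%:M) = 0.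
Proof.
move=> tA dA; rewrite mulmxBl !mulmxBr mul_scalar_mx mul_mx_scalar cayley_hamilton2.
rewrite tA dA -scalar_mxM; apply/matrixP=> i j; rewrite !mxE.
by case: (i == j); rewrite ?mulr1n ?mulr0n; ring.
Qed.

Lemma SL2_exp2 A : \det A = 1 -> A ^+ 2 = (-1)%:M + \tr A *: A.
Proof. by move=> dA; rewrite expr2 -mulmxE cayley_hamilton2 dA addrC raddfN. Qed.

(** A Chebyshev recursion: the coefficient of [A] in [A ^+ k] is a polynomial in the trace, and for
    nonscalar [A] the power is scalar exactly when it vanishes. *)
Lemma SL2_expS A k a b : \det A = 1 -> A ^+ k = a%:M + b *: A ->
  A ^+ k.+1 = (- b)%:M + (a + b * \tr A) *: A.
Proof.
move=> dA e; rewrite exprS e -mulmxE mulmxDr mul_mx_scalar -scalemxAr.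
rewrite cayley_hamilton2 dA; apply/matrixP=> i j; rewrite !mxE.
by case: (i == j); rewrite ?mulr1n ?mulr0n; ring.
Qed.

End Matrix2.

(** * Hyperplane sections of a quadric *)

Section PlaneSection.
Variables (F : finFieldType) (T : finType).
Implicit Types S : {set T}.

Lemma card_pair_inj S (f g : T -> F) :
  {in S &, forall x y, f x = f y -> g x = g y -> x = y} -> (#|S| <= #|F| ^ 2)%N.
Proof.
move=> inj; rewrite -mulnn -card_prod -(card_in_imset (f := fun x => (f x, g x))).
  exact: max_card.
by move=> x y Sx Sy [] /(inj x y Sx Sy).
Qed.

(** Eliminating [e1] makes the quadratic equation linear in [e3], with coefficient
    [a * e2 + c * e4]. Where this is nonzero, [e2] and [e4] determine the point; where it vanishes,
    [e4] gives [e2], and [e3], [e4] determine the point. *)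
Lemma card_plane_section S (e1 e2 e3 e4 : T -> F) eps a b c d mu :
    {in S &, forall x y, e1 x = e1 y -> e2 x = e2 y -> e3 x = e3 y ->
      e4 x = e4 y -> x = y} ->
    {in S, forall x, e1 x * e4 x - e2 x * e3 x = eps} ->
    {in S, forall x, a * e1 x + b * e2 x + c * e3 x + d * e4 x = mu} ->
  a != 0 -> (#|S| <= 2 * #|F| ^ 2)%N.
Proof.
move=> inj quad lin a0.
have lin1 x y : x \in S -> y \in S -> e2 x = e2 y -> e3 x = e3 y ->
  e4 x = e4 y -> e1 x = e1 y.
  move=> Sx Sy h2 h3 h4; apply: (mulfI a0).
  have := lin x Sx; rewrite -(lin y Sy) h2 h3 h4.
  by do 3!move/addIr.
rewrite -(cardsID [set x | a * e2 x + c * e4 x == 0] S) mul2n -addnn leq_add //.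
  apply: (card_pair_inj (f := e3) (g := e4)) => x y.
  rewrite !inE => /andP[Sx /eqP hx] /andP[Sy /eqP hy] h3 h4.
  have h2 : e2 x = e2 y.
    by apply: (mulfI a0); apply: (addIr (c * e4 x)); rewrite hx h4.
  by apply: inj => //; apply: lin1.
apply: (card_pair_inj (f := e2) (g := e4)) => x y.
rewrite !inE => /andP[hx Sx] /andP[hy Sy] h2 h4.
suff h3 : e3 x = e3 y by apply: inj => //; apply: lin1.
apply/eqP; rewrite -subr_eq0; apply/eqP; apply: (mulfI hx); rewrite mulr0.
have q : e1 x * e4 x - e2 x * e3 x = e1 y * e4 x - e2 x * e3 y.
  by rewrite quad // h2 h4 quad.
have l : a * e1 x + c * e3 x = a * e1 y + c * e3 y.
  have := lin x Sx; rewrite -(lin y Sy) h2 h4 => /addIr l.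
  by apply: (addIr (b * e2 y)); rewrite addrAC l addrAC.
have -> : (a * e2 x + c * e4 x) * (e3 x - e3 y) =
   e4 x * ((a * e1 x + c * e3 x) - (a * e1 y + c * e3 y)) -
   a * ((e1 x * e4 x - e2 x * e3 x) - (e1 y * e4 x - e2 x * e3 y)) by ring.
by rewrite l q !subrr !mulr0 subr0.
Qed.

End PlaneSection.

(** * Trace identities and their obstruction *)

Section TraceObstruction.
Variable F : fieldType.
Implicit Types (A B C : 'M[F]_2) (t : F).

(** The traces of elements of projective order 2 or 3. The conditions on the characteristic say that
    t^2 differs from 4, which excludes unipotent elements up to sign. *)
Definition small_trace t := (t = 0 /\ 2%:R != 0 :> F) \/ (t ^+ 2 = 1 /\ 3%:R != 0 :> F).

Lemma trace_mul_inv A B :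
  \tr (A *m B) + \tr (A *m ((\tr B)%:M - B)) = \tr A * \tr B.
Proof. by rewrite !mxtrace2 !mulmx2E !mxE /=; ring. Qed.

(** If [t], [u] and their sum all have square 1, then 2tu = -1, and squaring gives 3 = 0. *)
Lemma small_trace_split t u v w : v ^+ 2 = 1 -> w ^+ 2 = 1 -> t + u = v * w ->
  small_trace t -> small_trace u -> (t = 0 \/ u = 0) /\ 2%:R != 0 :> F.
Proof.
move=> v2 w2 e [[-> n2]|[t2 n3]]; first by split=> //; left.
case=> [[-> n2]|[u2 _]]; first by split=> //; right.
have tu2 : (t * u) *+ 2 = - 1.
  have : (t + u) ^+ 2 = 1 by rewrite e exprMn v2 w2 mulr1.
  by rewrite sqrrD t2 u2 => h; apply: (lincomb1 (k := 1) _ h); ring.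
have : (3%:R : F) = 0.
  have h : ((t * u) *+ 2) ^+ 2 = 1 by rewrite tu2 sqrrN expr1n.
  have h2 : (t * u) ^+ 2 = 1 by rewrite exprMn t2 u2 mulr1.
  have h3 : ((t * u) *+ 2) ^+ 2 = 4%:R by rewrite -mulr_natr exprMn h2 mul1r -natrX.
  by rewrite h3 in h; apply: (lincomb1 (k := 1) _ h); ring.
by move/eqP; rewrite (negPf n3).
Qed.

(** For s^2 = 1 each of the two binary forms on the left of the norm equation takes only the values
    0 and 1, while the right side is 3. For s = 0 four squares, each 0 or 1, add up to 4, so all are
    1, and the last two words give contradictory signs. *)
Lemma no_small_traces s t0 t1 t2 t3 : 2%:R != 0 :> F ->
    t0 ^+ 2 - s * t0 * t3 + t3 ^+ 2 + (t1 ^+ 2 + s * t1 * t2 + t2 ^+ 2) = 4%:R - s ^+ 2 ->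
    small_trace s -> small_trace t0 -> small_trace t1 -> small_trace t2 ->
    small_trace t3 -> small_trace (s * t0 - t3) -> small_trace (s * t1 + t2) ->
    small_trace (s * t0 ^+ 2 - t0 * t3 - t1 * t2 - s) ->
    small_trace (t0 * (t1 * s + t2) - t1 * t3) ->
  False.
Proof.
move=> n2 N.
have n4 : 4%:R != 0 :> F by rewrite (natrM _ 2 2) mulf_neq0.
have n1 : 1 != 0 :> F by rewrite oner_neq0.
have sq (t : F) : small_trace t -> t ^+ 2 = 0 \/ (t ^+ 2 = 1 /\ 3%:R != 0 :> F).
  by case=> [[-> _]|]; [left; rewrite expr0n | right].
(* If [x] and [y] are both nonzero, (x + ey)^2 = 2 + 2exy cannot be 1, so it is 0, exy = -1 and the
   form equals 1. *)
have part (x y e : F) : 3%:R != 0 :> F -> e ^+ 2 = 1 -> small_trace x -> small_trace y ->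
    small_trace (x + e * y) -> x ^+ 2 + e * x * y + y ^+ 2 = 0 \/
    x ^+ 2 + e * x * y + y ^+ 2 = 1.
  move=> n3 e2 Tx Ty Txy; have [[x0 _]|[x2 _]] := Tx.
    by rewrite x0 expr0n /= mulr0 mul0r !add0r; case: (sq _ Ty) => [|[]] ->; [left | right].
  have [[y0 _]|[y2 _]] := Ty; first by rewrite y0 expr0n /= mulr0 !addr0 x2; right.
  have q2 : (e * x * y) ^+ 2 = 1 by rewrite !exprMn e2 x2 y2 !mulr1.
  have E : (x + e * y) ^+ 2 = 2%:R + (e * x * y) *+ 2.
    by rewrite sqrrD exprMn e2 x2 y2 mul1r; ring.
  right; rewrite x2 y2; case: Txy => [[z0 _]|[z2 _]].
    move: E; rewrite z0 expr0n /= => E; apply: (mulfI n2).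
    by apply: (lincomb1 (k := -1) _ E); ring.
  exfalso; move: n3; rewrite (_ : 3%:R = 0) ?eqxx //.
  have h : (e * x * y) *+ 2 = - 1 by rewrite z2 in E; apply: (lincomb1 (k := -1) _ E); ring.
  have h4 : ((e * x * y) *+ 2) ^+ 2 = 4%:R by rewrite -mulr_natr exprMn q2 mul1r -natrX.
  by rewrite h sqrrN expr1n in h4; apply: (lincomb1 (k := -1) _ h4); ring.
case=> [[s0 _]|[s2 n3]] T0 T1 T2 T3 Tcba Tcaba Ty1 Ty2.
  rewrite s0 in N Ty1 Ty2; move: N; rewrite !mul0r subr0 addr0 expr0n /= subr0 => N.
  have [h0 [h1 [h2 h3]]] : t0 ^+ 2 = 1 /\ t1 ^+ 2 = 1 /\ t2 ^+ 2 = 1 /\ t3 ^+ 2 = 1.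
    move: N; case: (sq _ T0) => [->|[-> n30]]; case: (sq _ T1) => [->|[-> n31]];
      case: (sq _ T2) => [->|[-> n32]]; case: (sq _ T3) => [->|[-> n33]] N //;
      exfalso; do ?[match goal with H : is_true (?x != 0) |- _ =>
        by move: H; rewrite (_ : x = 0) ?eqxx //;
           apply: (lincomb1 (k := -1) _ N); ring end].
  have n3 : 3%:R != 0 :> F.
    by case: (sq _ T0) => [h|[]//]; move: n1; rewrite -h0 h eqxx.
  (* The last two words have squares 2 + 2q and 2 - 2q. Neither can be 1 since 3 is invertible, so
     both vanish, which gives q = -1 and q = 1. *)
  pose q := t0 * t1 * t2 * t3.
  have q2 : q ^+ 2 = 1 by rewrite !exprMn h0 h1 h2 h3 !mulr1.
  move: Ty1 Ty2; rewrite mul0r sub0r subr0 mulr0 add0r => Ty1 Ty2.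
  have E1 : (- (t0 * t3) - t1 * t2) ^+ 2 = 2%:R + q *+ 2.
    have -> : 2%:R = t0 ^+ 2 * t3 ^+ 2 + t1 ^+ 2 * t2 ^+ 2 :> F by rewrite h0 h1 h2 h3 !mulr1.
    by rewrite /q; ring.
  have E2 : (t0 * t2 - t1 * t3) ^+ 2 = 2%:R - q *+ 2.
    have -> : 2%:R = t0 ^+ 2 * t2 ^+ 2 + t1 ^+ 2 * t3 ^+ 2 :> F by rewrite h0 h1 h2 h3 !mulr1.
    by rewrite /q; ring.
  clearbody q; have no1 (z e : F) : e ^+ 2 = 1 -> z ^+ 2 = 2%:R + (e * q) *+ 2 ->
    small_trace z -> e * q = - 1.
    move=> e2 Ez [[z0 _]|[z2 _]].
      move: Ez; rewrite z0 expr0n /= => Ez; apply: (mulfI n2).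
      by apply: (lincomb1 (k := -1) _ Ez); ring.
    exfalso; move: n3; rewrite (_ : 3%:R = 0) ?eqxx //.
    have h : (e * q) *+ 2 = - 1 by rewrite z2 in Ez; apply: (lincomb1 (k := -1) _ Ez); ring.
    have h4 : ((e * q) *+ 2) ^+ 2 = 4%:R.
      by rewrite -mulr_natr !exprMn e2 q2 !mul1r -natrX.
    by rewrite h sqrrN expr1n in h4; apply: (lincomb1 (k := -1) _ h4); ring.
  have H1 := no1 _ 1 (expr1n _ _); rewrite mul1r in H1; have {}H1 := H1 _ E1 Ty1.
  have := no1 _ (-1) _ _ Ty2; rewrite sqrrN expr1n mulN1r mulNrn => H2.
  have {}H2 := H2 erefl E2; rewrite H1 opprK in H2.
  by move: n2; rewrite (_ : 2%:R = 0) ?eqxx //; apply: (lincomb1 (k := 1) _ H2); ring.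
have T4 : small_trace (t3 + - s * t0).
  by case: Tcba => [[e n]|[e n]]; [left|right]; split=> //;
    [rewrite -[RHS]oppr0 -e|rewrite -e]; ring.
have T5 : small_trace (t2 + s * t1) by rewrite addrC.
have ms2 : (- s) ^+ 2 = 1 by rewrite sqrrN.
have P1 := part _ _ _ n3 ms2 T3 T0 T4; have P2 := part _ _ _ n3 s2 T2 T1 T5.
have {}N : t3 ^+ 2 + - s * t3 * t0 + t0 ^+ 2 + (t2 ^+ 2 + s * t2 * t1 + t1 ^+ 2) = 3%:R.
  by rewrite s2 in N; apply: (lincomb1 (k := 1) _ N); ring.
case: P1 N => ->; case: P2 => -> N.
- by move: n3; rewrite -N addr0 eqxx.
- by move: n2; rewrite (_ : 2%:R = 0) ?eqxx //; apply: (lincomb1 (k := -1) _ N); ring.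
- by move: n2; rewrite (_ : 2%:R = 0) ?eqxx //; apply: (lincomb1 (k := -1) _ N); ring.
by move: n1; rewrite (_ : 1 = 0) ?eqxx //; apply: (lincomb1 (k := -1) _ N); ring.
Qed.

Section Words.
Variables A B C : 'M[F]_2.
Hypotheses (trA : \tr A = 0) (trB : \tr B = 0).
Hypotheses (detA : \det A = 1) (detB : \det B = 1) (detC : \det C = 1).
Let s := \tr (A *m B).
Let t0 := \tr C.
Let t1 := \tr (C *m A).
Let t2 := \tr (C *m B).
Let t3 := \tr (C *m A *m B).

Let a11 : A 1 1 = - A 0 0.
Proof. by move/eqP: trA; rewrite mxtrace2 addrC addr_eq0 => /eqP. Qed.
Let b11 : B 1 1 = - B 0 0.
Proof. by move/eqP: trB; rewrite mxtrace2 addrC addr_eq0 => /eqP. Qed.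

(* The norm of [C] in the basis [1, A, B, BA] of the quaternion algebra. *)
Lemma trace_norm :
  t0 ^+ 2 - s * t0 * t3 + t3 ^+ 2 + (t1 ^+ 2 + s * t1 * t2 + t2 ^+ 2) = 4%:R - s ^+ 2.
Proof.
have : \det A * \det B * t0 ^+ 2 - s * t0 * t3 + t3 ^+ 2
    + (\det B * t1 ^+ 2 + s * t1 * t2 + \det A * t2 ^+ 2)
  = (4%:R * \det A * \det B - s ^+ 2) * \det C.
  rewrite /s /t0 /t1 /t2 /t3 !det_mx2 !mxtrace2 !mulmx2E a11 b11; ring.
by rewrite detA detB detC !(mul1r, mulr1).
Qed.

(** This identity and the next rest on AB + BA = s and A^2 = -1, valid for trace 0 and determinant
    1. *)
Lemma trace_CBA : \tr (C *m B *m A) = s * t0 - t3.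
Proof. by rewrite /s /t0 /t3 !mxtrace2 !mulmx2E a11 b11; ring. Qed.

Lemma trace_CABA : \tr (C *m A *m B *m A) = s * t1 + t2.
Proof.
have : \tr (C *m A *m B *m A) = s * t1 + \det A * t2.
  by rewrite /s /t1 /t2 det_mx2 !mxtrace2 !mulmx2E a11 b11; ring.
by rewrite detA mul1r.
Qed.

Lemma trace_conj1 : \tr (B *m (t0%:M - C) *m A *m C) = s * t0 ^+ 2 - t0 * t3 - t1 * t2 - s.
Proof.
have : \tr (B *m (t0%:M - C) *m A *m C) = s * t0 ^+ 2 - t0 * t3 - t1 * t2 - \det C * s.
  by rewrite /s /t1 /t2 /t0 /t3 det_mx2 !mxtrace2 !mulmx2E !mxE /= a11 b11; ring.
by rewrite detC mul1r.
Qed.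

Lemma trace_conj2 :
  \tr (B *m (t0%:M - C) *m A *m C *m A) = t0 * (t1 * s + t2) - t1 * t3.
Proof.
have : \tr (B *m (t0%:M - C) *m A *m C *m A) = t0 * (t1 * s + \det A * t2) - t1 * t3.
  by rewrite /s /t1 /t2 /t0 /t3 !det_mx2 !mxtrace2 !mulmx2E !mxE /= a11 b11; ring.
by rewrite detA mul1r.
Qed.

Lemma trace_obstruction : 2%:R != 0 :> F ->
    small_trace s -> small_trace t0 -> small_trace t1 -> small_trace t2 ->
    small_trace t3 -> small_trace (\tr (C *m B *m A)) ->
    small_trace (\tr (C *m A *m B *m A)) ->
    small_trace (\tr (B *m (t0%:M - C) *m A *m C)) ->
    small_trace (\tr (B *m (t0%:M - C) *m A *m C *m A)) ->
  False.
Proof.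
move=> n2; rewrite trace_CBA trace_CABA trace_conj1 trace_conj2.
exact: no_small_traces trace_norm.
Qed.

End Words.
End TraceObstruction.

(** * Subgroups of SL(2, p) *)

Section SL2Algebra.
Variable p : nat.
Hypothesis p_pr : prime p.
Local Notation F := 'F_p.
Local Notation G := (SL2_group p).
Local Notation Z := ('Z(SL2 p))%g.
Local Notation m := (@GLval 2 F).
Implicit Types (u x y : {'GL_2(p)}) (v w : 'rV[F]_2).

Lemma GL2_eq u x : m u = m x -> u = x.
Proof. exact: val_inj. Qed.

Lemma valM u x : m (u * x)%g = m u *m m x.
Proof. by []. Qed.

Lemma valX u n : m (u ^+ n)%g = m u ^+ n.
Proof. by elim: n => // n IH; rewrite expgS exprS valM IH. Qed.

Lemma SL2E u : (u \in SL2 p) = (\det (m u) == 1).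
Proof. by rewrite inE. Qed.

Lemma det_SL2 u : u \in SL2 p -> \det (m u) = 1.
Proof. by rewrite inE => /eqP. Qed.

Lemma SL2_lift (A : 'M[F]_2) : \det A = 1 -> exists2 u, u \in SL2 p & m u = A.
Proof.
move=> dA; have uA : A \is a GRing.unit by rewrite unitmxE dA unitr1.
by exists (FinRing.Unit uA); rewrite ?SL2E /= ?dA.
Qed.

Lemma SL2_invE u : u \in SL2 p -> m u^-1%g = (\tr (m u))%:M - m u.
Proof.
move=> Gu; have e : m u *m ((\tr (m u))%:M - m u) = 1%:M.
  rewrite mulmxBr mul_mx_scalar cayley_hamilton2 det_SL2 //.
  by rewrite opprB addrC subrK.
have {}e : m u^-1%g *m (m u *m ((\tr (m u))%:M - m u)) = m u^-1%g by rewrite e mulmx1.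
by rewrite -e mulmxA -valM mulVg mul1mx.
Qed.

Lemma mulKval u (A : 'M[F]_2) : m u^-1%g *m (m u *m A) = A.
Proof. by rewrite mulmxA -valM mulVg mul1mx. Qed.

Lemma commuteE u x : (x \in 'C[u]%g) = (m u *m m x == m x *m m u).
Proof.
by apply/cent1P/eqP; rewrite -!valM => e; [rewrite e | apply/GL2_eq; rewrite e].
Qed.

Lemma commute_scalar u : ~~ nonscalar (m u) -> 'C[u]%g = setT.
Proof.
move/nonscalarPn=> e; apply/setP=> x; rewrite commuteE inE e.
by rewrite mul_scalar_mx mul_mx_scalar eqxx.
Qed.

Lemma commute_span x y : nonscalar (m x) -> y \in 'C[x]%g ->
  exists a b, m y = a%:M + b *: m x.
Proof. by move=> nx; rewrite commuteE => /eqP /(commute_nonscalar nx). Qed.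

Lemma abelian_cent1 x : nonscalar (m x) -> abelian ('C_G[x])%g.
Proof.
move=> nx; apply: (abelianS (subsetIr _ _)); apply/centsP=> y Cy z Cz.
have [a [b ey]] := commute_span nx Cy.
have [c [d ez]] := commute_span nx Cz.
apply/cent1P; rewrite cent1C commuteE ey ez; apply/eqP.
exact: span_commute.
Qed.

Lemma transvecX v s u n : m u = transvec v s -> m (u ^+ n)%g = transvec v (s *+ n).
Proof.
move=> e; elim: n => [|n IH]; first by rewrite expg0 mulr0n transvec0.
by rewrite expgSr valM IH e transvecD mulrSr.
Qed.

(** Over a prime field the powers of a nontrivial transvection exhaust its root subgroup. *)
Lemma transvec_mem (H : {group {'GL_2(p)}}) v s t u :
  u \in H -> m u = transvec v s -> s != 0 ->
  exists2 y, y \in H & m y = transvec v t.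
Proof.
move=> Hu e s0; exists (u ^+ (nat_of_ord (t / s)%R))%g; first exact: groupX.
rewrite (transvecX _ e); congr transvec.
by rewrite -mulr_natr natr_Zp mulrC divfK.
Qed.

Lemma transvec_neq1 v s : v != 0 -> s != 0 -> transvec v s != 1%:M.
Proof.
move=> v0 s0; apply: contra v0 => /eqP e; apply/eqP/rv2P; rewrite !mxE.
  have := congr1 (fun A : 'M_2 => A 1 0) e; rewrite !mxE /= add0r => /eqP.
  by rewrite mulf_eq0 mulf_eq0 (negPf s0) /= orbb => /eqP.
have := congr1 (fun A : 'M_2 => A 0 1) e; rewrite !mxE /= add0r => /eqP.
by rewrite mulf_eq0 mulf_eq0 oppr_eq0 (negPf s0) /= orbb => /eqP.
Qed.

Lemma Fp_pchar : p \in [pchar F].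
Proof. exact: pchar_Fp. Qed.

Lemma order_transvec v s u : v != 0 -> s != 0 -> m u = transvec v s -> #[u]%g = p.
Proof.
move=> v0 s0 e; apply: nt_prime_order => //.
  apply/GL2_eq; rewrite (transvecX _ e) -mulr_natr (pcharf0 Fp_pchar) mulr0.
  by rewrite transvec0.
by apply: contra (transvec_neq1 v0 s0) => /eqP u1; rewrite -e u1.
Qed.

(** Two transvections along different lines yield both root subgroups, hence the big cell by
    [SL2_decomp]. *)
Lemma SL2_gen_transvec (H : {group {'GL_2(p)}}) v w s t x y :
  x \in H -> y \in H -> m x = transvec v s -> m y = transvec w t ->
  s != 0 -> t != 0 -> cross v w != 0 -> SL2 p \subset H.
Proof.
move=> Hx Hy ex ey s0 t0 D.
have mem A : \det A = 1 -> cross v (v *m A) != 0 ->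
  exists2 g, g \in H & m g = A.
  move=> dA b0; have [a [b [c ->]]] := SL2_decomp D dA b0.
  have [g1 H1 <-] := transvec_mem a Hx ex s0.
  have [g2 H2 <-] := transvec_mem b Hy ey t0.
  have [g3 H3 <-] := transvec_mem c Hx ex s0.
  by exists (g1 * g2 * g3)%g; rewrite ?groupM // !valM.
apply/subsetP=> g /det_SL2 dg.
have [b0|b0] := eqVneq (cross v (v *m m g)) 0; last first.
  by have [g' Hg' /GL2_eq <-] := mem _ dg b0.
(* Outside the big cell [g] preserves the line of [v]; multiplied by a transvection along [w] it no
   longer does. *)
have [| |g' Hg' e] := mem (transvec w 1 *m m g).
- by rewrite det_mulmx det_transvec dg mulr1.
- rewrite mulmxA mul_transvec mulmxDl -scalemxAl mul1r.
  rewrite crossDr crossZr b0 add0r (crossC w) mulf_neq0 ?oppr_eq0 //.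
  apply: contra D => /eqP b1.
  have := cross_mul v w (m g); rewrite dg mul1r => <-.
  have [->|v0] := eqVneq v 0; first by rewrite mul0mx cross0l.
  have [k ->] := cross_eq0 v0 b0; have [l ->] := cross_eq0 v0 b1.
  by rewrite crossZr (crossC _ v) crossZr cross_vv mulr0 oppr0 mulr0.
have [h Hh eh] := transvec_mem (- 1) Hy ey t0.
have -> : g = (h * g')%g.
  by apply/GL2_eq; rewrite valM e eh mulmxA transvecD addNr transvec0 mul1mx.
exact: groupM.
Qed.

Definition fixes v u := [exists k, v *m m u == k *: v].

Lemma fixesP v u : reflect (exists k, v *m m u = k *: v) (fixes v u).
Proof. by apply: (iffP existsP) => -[k /eqP e]; exists k. Qed.

Lemma fixes_group_set v : group_set [set u | fixes v u].
Proof.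
apply/group_setP; split=> [|x y]; rewrite !inE.
  by apply/fixesP; exists 1; rewrite mulmx1 scale1r.
move=> /fixesP[k ek] /fixesP[l el]; apply/fixesP; exists (k * l).
by rewrite valM mulmxA ek -scalemxAl el scalerA.
Qed.

Definition line_stab v := Group (fixes_group_set v).

Lemma transvec_conj v s u h : h \in SL2 p -> m u = transvec v s ->
  m (u ^ h)%g = transvec (v *m m h) s.
Proof.
move=> /det_SL2 dh e; have uh : m h *m m (u ^ h)%g = m u *m m h.
  by rewrite -!valM conjgE mulKVg.
have e2 : m h *m transvec (v *m m h) s = m u *m m h by rewrite e transvec_mulC.
have : m (h^-1)%g *m (m h *m m (u ^ h)%g) = m (h^-1)%g *m (m h *m transvec (v *m m h) s).
  by rewrite uh e2.
by rewrite !mulKval.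
Qed.

(** By Frobenius, (u - 1)^p = u^p - 1 = 0, so u - 1 is nilpotent. *)
Lemma order_p_transvec u : u \in SL2 p -> #[u]%g = p ->
  exists v s, [/\ v != 0, s != 0 & m u = transvec v s].
Proof.
move=> Gu ou; pose n := m u - 1.
have chM : p \in [pchar 'M[F]_2] by rewrite pchar_lalg Fp_pchar.
have np : n ^+ p = 0.
  have c1 : GRing.comm (m u) (- 1) by apply/commrN/commr1.
  have := pFrobenius_autD_comm chM c1; rewrite !pFrobenius_autE -/n => ->.
  have up : (u ^+ p)%g = 1%g by have := expg_order u; rewrite ou.
  have -> : m u ^+ p = 1 by rewrite -valX up.
  have -> : (-1) ^+ p = - (1 : 'M[F]_2); last by rewrite subrr.
  have := pFrobenius_autN chM 1; rewrite !pFrobenius_autE => ->.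
  by rewrite expr1n.
have [|d0 t0] := nilpotent2 _ np; first by rewrite subrK (det_SL2 Gu).
have [|v [s [v0 s0 e]]] := nilpotent_transvec _ d0 t0; last first.
  by exists v, s; split; rewrite // -e subrK.
rewrite subr_eq0.
by apply: contraTneq (prime_gt1 p_pr) => e1; have := ou;
  rewrite (GL2_eq (x := 1%g) e1) order1 => <-.
Qed.

(** Cauchy provides a transvection in [H]. Either all of [H] preserves its line, or a conjugate has
    another line and the two generate. *)
Lemma SL2_subgroup_dvdp (H : {group {'GL_2(p)}}) : H \subset SL2 p -> (p %| #|H|)%N ->
  SL2 p \subset H \/ exists2 v, v != 0 & H \subset line_stab v.
Proof.
move=> sHG /(Cauchy p_pr)[u Hu ou].
have [v [s [v0 s0 e]]] := order_p_transvec (subsetP sHG u Hu) ou.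
have [sHv|/subsetPn[h Hh]] := boolP (H \subset line_stab v); first by right; exists v.
rewrite inE => nfix; left.
have Huh : (u ^ h)%g \in H by rewrite groupJ.
apply: (SL2_gen_transvec Hu Huh e (transvec_conj (subsetP sHG h Hh) e) s0 s0).
apply: contra nfix => /eqP /(cross_eq0 v0)[k ek]; apply/fixesP; by exists k.
Qed.

Lemma transvec_lift v s : exists2 u, u \in SL2 p & m u = transvec v s.
Proof. by apply: SL2_lift; rewrite det_transvec. Qed.

Lemma mem_center u : u \in SL2 p -> (u \in Z) = ~~ nonscalar (m u).
Proof.
move=> Gu; apply/idP/idP => [/setIP[_ /centP cu] | /commute_scalar cu]; last first.
  by rewrite inE Gu /= -sub_cent1 cu subsetT.
apply/negP => /nonscalar_moves[v v0]; have [x Gx ex] := transvec_lift v 1.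
have : m (u * x)%g = m (x * u)%g by rewrite (cu x Gx).
rewrite !valM ex => /(congr1 (mulmx v)); rewrite !mulmxA !mul_transvec.
rewrite cross_vv mulr0 scale0r addr0 mul1r => /eqP.
by rewrite -subr_eq0 addrC addKr scaler_eq0 (negPf v0) orbF => ->.
Qed.

Lemma center_scalar u : u \in Z -> exists2 a, a ^+ 2 = 1 & m u = a%:M.
Proof.
move=> Zu; have Gu : u \in SL2 p by case/setIP: Zu.
move: (Zu); rewrite mem_center // => /nonscalarPn e; exists (m u 0 0) => //.
by have := det_SL2 Gu; rewrite {1}e det_scalar.
Qed.

Lemma Fp_two_eq0 : (2%:R == 0 :> F) = (p == 2)%N.
Proof.
apply/idP/eqP => [|->]; last by rewrite (pcharf0 (pchar_Fp (isT : prime 2))).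
move=> e; have := dvdn_pcharf Fp_pchar 2; rewrite e.
by rewrite dvdn_prime2 // => /eqP.
Qed.

Lemma center_exp2 u : u \in Z -> (u ^+ 2 = 1)%g.
Proof.
by case/center_scalar=> a a2 e; apply/GL2_eq; rewrite valX e -rmorphXn a2.
Qed.

Lemma center_p2 u : p = 2%N -> u \in Z -> u = 1%g.
Proof.
move=> p2 /center_scalar[a a2 e]; apply/GL2_eq; rewrite e.
suff -> : a = 1 by [].
have e2 : 2%:R = 0 :> F by apply/eqP; rewrite Fp_two_eq0 p2.
apply/eqP; rewrite -subr_eq0 -sqrf_eq0; apply/eqP.
by rewrite sqrrB1 a2 -(mulr_natr a) e2 mulr0 subr0 -[1 + 1]/(2%:R) e2.
Qed.

(** If u = kz with [z] central, then k^2 = u^2. For odd [p] the square of a transvection is still a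
    nontrivial one; for p = 2 the centre is trivial. *)
Lemma SL2_sub_mul_center (K : {group {'GL_2(p)}}) :
  SL2 p \subset (K * Z)%g -> SL2 p \subset K.
Proof.
move=> sGKZ; have mem v : v != 0 -> exists x s, [/\ x \in K, s != 0 & m x = transvec v s].
  move=> v0; have [u Gu eu] := transvec_lift v 1.
  have /mulsgP[k z Kk Zz ek] := subsetP sGKZ u Gu.
  have [p2|p2] := eqVneq p 2%N.
    exists k, 1; split; rewrite ?oner_eq0 // -eu.
    by rewrite ek (center_p2 p2 Zz) mulg1.
  exists (k ^+ 2)%g, 2%:R; split; [exact: groupX | by rewrite Fp_two_eq0|].
  have -> : (k ^+ 2 = u ^+ 2)%g.
    have /setIP[_ /centP cz] := Zz.
    rewrite ek expgMn; first by rewrite (center_exp2 Zz) mulg1.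
    rewrite /commute; have Gk : k \in SL2 p.
      rewrite -(groupMr _ (_ : z \in SL2 p)) -?ek //; by case/setIP: Zz.
    by rewrite cz.
  by rewrite (transvecX _ eu) -mulr_natr mul1r.
have [|x [s [Kx s0 ex]]] := mem (\row_j (j == 0)%:R).
  by apply/eqP=> /rowP/(_ 0); rewrite !mxE => /eqP; rewrite oner_eq0.
have [|y [t [Ky t0 ey]]] := mem (\row_j (j == 1)%:R).
  by apply/eqP=> /rowP/(_ 1); rewrite !mxE => /eqP; rewrite oner_eq0.
apply: (SL2_gen_transvec Kx Ky ex ey s0 t0) => //.
by rewrite /cross !mxE /= mulr1 mulr0 subr0 oner_eq0.
Qed.

Lemma tr_conj x g : \tr (m (x ^ g)%g) = \tr (m x).
Proof.
rewrite conjgE valM valM mxtrace_mulC -mulmxA -valM.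
by rewrite mulgV mulmx1.
Qed.

(** With a double eigenvalue [e], Frobenius makes u^p the scalar e^p. Were the order prime to [p],
    [u] would be a power of this central element. *)
Lemma order_p_trace u : u \in SL2 p -> nonscalar (m u) -> \tr (m u) ^+ 2 = 4%:R ->
  (p %| #[u]%g)%N.
Proof.
move=> Gu nu t4; apply: contraT => ndv.
have [e et e2] : exists2 e, \tr (m u) = e *+ 2 & e ^+ 2 = 1.
  have [p2|p2] := eqVneq p 2%N.
    have e2 : 2%:R = 0 :> F by apply/eqP; rewrite Fp_two_eq0 p2.
    exists 1; rewrite ?expr1n // e2; apply/eqP.
    by rewrite -sqrf_eq0 t4 (natrM _ 2 2) e2 mulr0.
  have n2 : 2%:R != 0 :> F by rewrite Fp_two_eq0.
  exists (\tr (m u) / 2%:R); first by rewrite -(mulr_natr (_ / _)) divfK.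
  by rewrite expr_div_n t4 (natrX _ 2 2) divff ?expf_neq0.
have chM : p \in [pchar 'M[F]_2] by rewrite pchar_lalg Fp_pchar.
pose n := m u - e%:M.
have n2 : n ^+ 2 = 0.
  by rewrite expr2 -mulmxE double_root_sqr0 // e2 det_SL2.
have np : n ^+ p = 0.
  suff nk k : (1 < k)%N -> n ^+ k = 0 by apply: nk; exact: prime_gt1.
  by case: k => [|[|k]] // _; rewrite (exprD n 2 k) n2 mul0r.
have up : m (u ^+ p)%g = (e ^+ p)%:M.
  have c1 : GRing.comm n e%:M by rewrite /GRing.comm -!mulmxE mul_scalar_mx mul_mx_scalar.
  have := pFrobenius_autD_comm chM c1; rewrite !pFrobenius_autE np add0r subrK.
  by rewrite valX => ->; rewrite rmorphXn.
have : u \in <[u ^+ p]>%g.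
  have : generator <[u]>%g (u ^+ p)%g by rewrite generator_coprime coprime_sym prime_coprime.
  by rewrite /generator => /eqP <-; apply: cycle_id.
have : (u ^+ p)%g \in Z.
  rewrite mem_center ?groupX // up -[(_)%:M]addr0 -(scale0r (1%:M : 'M_2)).
  by rewrite nonscalar_span eqxx.
rewrite -cycle_subG => /subsetP sc; by move/sc; rewrite mem_center // nu.
Qed.

(** Write y = a + bx. Trace and determinant give (t^2 - 4)(b^2 - 1) = 0, and t^2 is not 4. *)
Lemma cent1_trace x y : x \in SL2 p -> nonscalar (m x) -> \tr (m x) ^+ 2 != 4%:R ->
  y \in SL2 p -> y \in 'C[x]%g -> \tr (m y) = \tr (m x) -> y = x \/ y = x^-1%g.
Proof.
move=> Gx nx t4 Gy Cy ty; have [a [b ey]] := commute_span nx Cy.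
set t := \tr (m x) in t4 ty.
have e1 : a *+ 2 + b * t = t.
  by rewrite -[RHS]ty ey mxtraceD mxtrace_scalar mxtraceZ mulr2n.
have e2 : a ^+ 2 + a * b * t + b ^+ 2 = 1.
  have := det_SL2 Gy; rewrite ey det_mx2 !mxE /= => <-.
  have := det_SL2 Gx; rewrite det_mx2 => dx.
  rewrite -[b ^+ 2]mulr1 -dx /t mxtrace2; ring.
have b1 : (b - 1) * (b + 1) = 0.
  have ea : a *+ 2 = t * (1 - b) by apply: (lincomb1 (k := 1) _ e1); ring.
  have e4 : (a *+ 2) ^+ 2 + (a *+ 2) * b * t *+ 2 + b ^+ 2 *+ 4 = 4%:R.
    by apply: (lincomb1 (k := 4%:R) _ e2); ring.
  have : (t ^+ 2 - 4%:R) * ((b - 1) * (b + 1)) = 0.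
    by rewrite ea in e4; apply: (lincomb1 (k := -1) _ e4); ring.
  by move/eqP; rewrite mulf_eq0 subr_eq0 (negPf t4) => /eqP.
have b2 : b ^+ 2 = 1 by apply: (lincomb1 (k := 1) _ b1); ring.
have a0 : a * (a + b * t) = 0.
  by rewrite b2 in e2; apply: (lincomb1 (k := 1) _ e2); ring.
have inv_x : m x^-1%g = t%:M - m x by rewrite SL2_invE.
have xt : a = 0 -> b = 1 -> y = x.
  by move=> ea eb; apply/GL2_eq; rewrite ey ea eb raddf0 add0r scale1r.
have yt : a = t -> b = -1 -> y = x^-1%g.
  by move=> ea eb; apply/GL2_eq; rewrite inv_x ey ea eb scaleN1r.
(* The mismatched sign choices occur only if t = 0, where x^-1 = -x, or if 1 = -1; they still give
   [x] or its inverse. *)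
have alt : t *+ 2 = 0 -> t = 0 \/ (1 = -1 :> F).
  rewrite -mulr_natr => /eqP; rewrite mulf_eq0 => /orP[/eqP|]; first by left.
  by rewrite (_ : 2%:R = 1 + 1) // addr_eq0 => /eqP; right.
move/eqP: b1; rewrite mulf_eq0 subr_eq0 addr_eq0.
move/eqP: a0; rewrite mulf_eq0 addr_eq0 => /orP[]/eqP ea /orP[]/eqP eb; rewrite eb in ea e1.
- by left; apply: xt.
- have [|t0|n1] := alt; first by rewrite ea in e1; apply: (lincomb1 (k := -1) _ e1); ring.
    by right; apply: yt; rewrite ?t0.
  by left; apply: xt; rewrite // eb -n1.
- have [|t0|n1] := alt; first by rewrite ea in e1; apply: (lincomb1 (k := -1) _ e1); ring.
    by left; apply: xt; rewrite // ea t0 mulr0 oppr0.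
  by right; apply: yt; rewrite ?eb // ea n1 mulN1r opprK.
by right; apply: yt; rewrite // ea mulN1r opprK.
Qed.

(** An element normalizing the centralizer sends [x] to a member of it with the same trace, that is
    to [x] or its inverse, which leaves at most two cosets. *)
Lemma SL2_cent1_index (H : {group {'GL_2(p)}}) x :
    H \subset SL2 p -> x \in H -> nonscalar (m x) -> \tr (m x) ^+ 2 != 4%:R ->
  (#|'N_H('C_H[x]) : 'C_H[x]|%g <= 2)%N.
Proof.
move=> sHG Hx nx t4; set C := ('C_H[x])%g.
have sCN : C \subset ('N_H(C))%g by rewrite subsetI subsetIl normG.
have xC : x \in C by rewrite inE Hx cent1id.
have inv g : g \in ('N_H(C))%g -> g \in C \/ (x ^ g = x^-1)%g.
  case/setIP=> Hg /normP nCg; have Cxg : (x ^ g)%g \in C by rewrite -nCg memJ_conjg.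
  have /setIP[Hxg cxg] := Cxg.
  have [|e|e] := cent1_trace (subsetP sHG x Hx) nx t4 (subsetP sHG _ Hxg) cxg.
  - exact: tr_conj.
  - by left; rewrite inE Hg cent1C; apply/cent1P/commgP/conjg_fixP.
  by right.
have [sNC|/subsetPn[g Ng nCg]] := boolP (('N_H(C))%g \subset C).
  by rewrite -indexg_eq1 in sNC; rewrite (eqP sNC).
rewrite -(leq_pmul2l (cardG_gt0 [group of C])) Lagrange //.
have xg : (x ^ g = x^-1)%g by case: (inv g Ng) nCg => // ->.
apply: leq_trans (_ : #|C :|: (C :* g)%g| <= _)%N.
  apply: subset_leq_card; apply/subsetP=> h Nh; rewrite inE; have [->//|xh] := inv h Nh.
  apply/orP; right; rewrite mem_rcoset inE groupM ?groupV //=; last by case/setIP: Ng.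
    by rewrite cent1C; apply/cent1P/commgP/conjg_fixP; rewrite conjgM xh -xg conjgK.
  by case/setIP: Nh.
by rewrite (leq_trans (leq_card_setU _ _)) // card_rcoset muln2 addnn.
Qed.

Lemma SL2_trace_coprime (H : {group {'GL_2(p)}}) x :
    H \subset SL2 p -> ~~ (p %| #|H|)%N -> x \in H -> nonscalar (m x) ->
  \tr (m x) ^+ 2 != 4%:R.
Proof.
move=> sHG ndv Hx nx; apply: contra ndv => /eqP t4.
by apply: dvdn_trans (order_dvdG Hx); apply: order_p_trace; rewrite ?(subsetP sHG).
Qed.

Lemma mem_center_sub (H : {group {'GL_2(p)}}) x :
    H \subset SL2 p -> x \in H :\: Z -> nonscalar (m x).
Proof.
move=> sHG /setDP[Hx]; apply: contraR; rewrite mem_center //; exact: (subsetP sHG).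
Qed.

Lemma SL2_trichotomy (H : {group {'GL_2(p)}}) x :
    H \subset SL2 p -> Z \subset H -> ~~ (p %| #|H|)%N -> x \in H :\: Z ->
    (4 * #|Z| <= #|'C_H[x]%g|)%N ->
  [\/ H \subset 'N('C_H[x])%g,
      #|'C_H[x]%g| = (4 * #|Z|)%N /\ #|H| = (24 * #|Z|)%N |
      #|'C_H[x]%g| = (5 * #|Z|)%N /\ #|H| = (60 * #|Z|)%N].
Proof.
move=> sHG sZH ndv Hx; apply: centralizer_trichotomy => //.
- by rewrite centsC (subset_trans sHG) // centsC subsetIr.
- move=> y Hy; apply: abelianS (abelian_cent1 (mem_center_sub sHG Hy)).
  exact: setSI.
move=> y Hy; have ny := mem_center_sub sHG Hy; have [Hy1 _] := setDP Hy.
by apply: SL2_cent1_index => //; apply: SL2_trace_coprime Hy1 ny.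
Qed.

Lemma leq_card_cent1 (H : {group {'GL_2(p)}}) x n :
    H \subset SL2 p -> Z \subset H -> x \in H ->
    (forall j, 0 < j < n -> (x ^+ j)%g \notin Z)%N ->
  (n * #|Z| <= #|'C_H[x]%g|)%N.
Proof.
move=> sHG sZH Hx nZ; have Gx := subsetP sHG x Hx.
have cZ : Z \subset 'C_H[x]%g.
  by rewrite subsetI sZH sub_cent1; apply: (subsetP _ x Gx); rewrite centsC subsetIr.
have nZG : SL2 p \subset 'N(Z)%g by apply: cents_norm; rewrite centsC subsetIr.
rewrite -(Lagrange cZ) mulnC leq_pmul2l ?cardG_gt0 // -card_quotient; last first.
  by rewrite (subset_trans _ nZG) // subIset // sHG.
have le : (n <= #[coset Z x]%g)%N.
  rewrite leqNgt; apply/negP => lt; have := nZ #[coset Z x]%g; rewrite order_gt0 lt => /(_ isT).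
  have Nx := subsetP nZG x Gx.
  by rewrite coset_idr // ?groupX // morphX // expg_order.
apply: leq_trans le _; rewrite orderE; apply/subset_leq_card.
by rewrite cycle_subG mem_quotient // inE Hx cent1id.
Qed.

End SL2Algebra.

(** * Counting the elements that generate SL(2, p) together with a given one *)

Section Generation.
Variable p : nat.
Hypothesis p_pr : prime p.
Local Notation F := 'F_p.
Local Notation G := (SL2_group p).
Local Notation Z := ('Z(SL2 p))%g.
Local Notation m := (@GLval 2 F).
Implicit Types (g u x y : {'GL_2(p)}) (v w : 'rV[F]_2).

Definition linear_section (q : F * F * F * F) mu : {set {'GL_2(p)}} :=
  [set x in SL2 p | let: (a, b, c, d) := q in
    a * m x 0 0 + b * m x 0 1 + c * m x 1 0 + d * m x 1 1 == mu].

(** Any entry with nonzero coefficient can play the part of [e1]; an off-diagonal one changes the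
    sign of the quadric, hence [eps] = -1. *)
Lemma card_linear_section q mu : q != (0, 0, 0, 0) ->
  (#|linear_section q mu| <= 2 * p ^ 2)%N.
Proof.
case: q => [[[a b] c] d] nz; rewrite -[in leqRHS](card_Fp p_pr).
have inj : {in linear_section (a, b, c, d) mu &, forall x y, m x 0 0 = m y 0 0 ->
    m x 0 1 = m y 0 1 -> m x 1 0 = m y 1 0 -> m x 1 1 = m y 1 1 -> x = y}.
  by move=> x y _ _ *; apply/GL2_eq/matrix2P.
have quad : {in linear_section (a, b, c, d) mu, forall x,
    m x 0 0 * m x 1 1 - m x 0 1 * m x 1 0 = 1}.
  by move=> x; rewrite inE => /andP[/det_SL2 <- _]; rewrite det_mx2.
have lin : {in linear_section (a, b, c, d) mu, forall x,
    a * m x 0 0 + b * m x 0 1 + c * m x 1 0 + d * m x 1 1 = mu}.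
  by move=> x; rewrite inE => /andP[_ /eqP].
have [a0|a0] := eqVneq a 0; last first.
  exact: (card_plane_section (e1 := fun x => m x 0 0) (e2 := fun x => m x 0 1)
    (e3 := fun x => m x 1 0) (e4 := fun x => m x 1 1) inj quad lin a0).
have [b0|b0] := eqVneq b 0; last first.
  apply: (card_plane_section (e1 := fun x => m x 0 1) (e2 := fun x => m x 0 0)
    (e3 := fun x => m x 1 1) (e4 := fun x => m x 1 0) (eps := -1) (b := a) (c := d)
    (d := c) (mu := mu)) b0 => [x y Sx Sy *|x Sx|x Sx].
  - exact: inj.
  - by rewrite -(quad x Sx); ring.
  - by rewrite -(lin x Sx); ring.
have [c0|c0] := eqVneq c 0; last first.
  apply: (card_plane_section (e1 := fun x => m x 1 0) (e2 := fun x => m x 0 0)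
    (e3 := fun x => m x 1 1) (e4 := fun x => m x 0 1) (eps := -1) (b := a) (c := d)
    (d := b) (mu := mu)) c0 => [x y Sx Sy *|x Sx|x Sx].
  - exact: inj.
  - by rewrite -(quad x Sx); ring.
  - by rewrite -(lin x Sx); ring.
have d0 : d != 0 by apply: contra nz => /eqP->; rewrite a0 b0 c0.
apply: (card_plane_section (e1 := fun x => m x 1 1) (e2 := fun x => m x 0 1)
  (e3 := fun x => m x 1 0) (e4 := fun x => m x 0 0) (eps := 1) (b := b) (c := c)
  (d := a) (mu := mu)) d0 => [x y Sx Sy *|x Sx|x Sx].
- exact: inj.
- by rewrite -(quad x Sx); ring.
- by rewrite -(lin x Sx); ring.
Qed.

Lemma card_SL2_ge : ((p - 1) * p ^ 2 <= #|SL2 p|)%N.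
Proof.
pose good (q : F * F * F) x :=
  [&& x \in SL2 p, m x 0 0 == q.1.1, m x 0 1 == q.1.2 & m x 1 0 == q.2].
have lift q : exists x, (q.1.1 != 0) ==> good q x.
  have [q0|q0] := eqVneq q.1.1 0; first by exists 1%g; rewrite implyFb.
  pose A : 'M[F]_2 := \matrix_(i, j) if i == 0 then (if j == 0 then q.1.1 else q.1.2)
     else if j == 0 then q.2 else (1 + q.1.2 * q.2) / q.1.1.
  have dA : \det A = 1 by rewrite det_mx2 !mxE /= mulrC divfK // addrK.
  have [x Gx e] := SL2_lift dA; exists x => /=.
  by rewrite /good Gx e !mxE /= !eqxx.
pose f q := xchoose (lift q).
have fP q : q.1.1 != 0 -> good q (f q) by move: (xchooseP (lift q)) => /implyP.
pose D := [set q : F * F * F | q.1.1 != 0].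
have <- : #|f @: D| = ((p - 1) * p ^ 2)%N.
  rewrite card_in_imset; last first.
    move=> [[a b] c] [[a' b'] c']; rewrite !inE => /fP /and4P[_ /eqP e1 /eqP e2 /eqP e3].
    move=> /fP /and4P[_ /eqP h1 /eqP h2 /eqP h3] e.
    by move: e1 e2 e3; rewrite e h1 h2 h3 /= => -> -> ->.
  have DE : D =i setX (setX [set~ 0] setT) setT.
    by move=> q; rewrite !inE !andbT.
  rewrite (eq_card DE).
  by rewrite !cardsX !cardsT cardsC1 card_Fp // subn1 -mulnA mulnn.
apply/subset_leq_card/subsetP=> _ /imsetP[q Dq ->].
by move: Dq; rewrite inE => /fP /and4P[].
Qed.

Lemma card_SL2_le : (#|SL2 p| <= p ^ 4)%N.
Proof.
rewrite -(card_in_imset (f := m)); last by move=> x y _ _; apply: GL2_eq.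
by rewrite (leq_trans (max_card _)) // card_mx card_Fp.
Qed.

Lemma gen_mul_center (A : {set {'GL_2(p)}}) :
  A \subset SL2 p -> SL2 p \subset <<A :|: Z>>%g -> <<A>>%g = SL2 p.
Proof.
move=> sA sG; apply/eqP; rewrite eqEsubset (gen_subG _ G) sA /=.
apply: (SL2_sub_mul_center p_pr (K := [group of <<A>>%g])).
rewrite /= -norm_joinEr; last first.
  by apply: cents_norm; rewrite centsC gen_subG (subset_trans sA) // centsC subsetIr.
by rewrite joing_idl.
Qed.

(** A transvection along a line moved by [g], and its conjugate by [g], already generate. *)
Lemma exists_cogenerator g : g \in SL2 p -> g \notin Z ->
  exists2 x, x \in SL2 p & <<[set x; g]>>%g = SL2 p.
Proof.
move=> Gg; rewrite mem_center // negbK => /nonscalar_moves[v v0 vg].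
have [x Gx ex] := transvec_lift v 1; exists x => //.
apply/eqP; rewrite eqEsubset (gen_subG _ G); apply/andP; split.
  by apply/subsetP=> y; rewrite !inE => /orP[]/eqP->; rewrite -?SL2E.
have Hx : x \in <<[set x; g]>>%g by rewrite mem_gen // !inE eqxx.
have Hg : g \in <<[set x; g]>>%g by rewrite mem_gen // !inE eqxx orbT.
apply: (SL2_gen_transvec (H := [group of <<[set x; g]>>%g]) Hx (groupJ Hx Hg) ex
  (transvec_conj Gg ex)) => //; exact: oner_neq0.
Qed.

Lemma root_count (P : {poly F}) : P != 0 ->
  (#|[set x | root P x]| <= (size P).-1)%N.
Proof.
move=> P0; rewrite cardE -ltnS prednK ?size_poly_gt0 //; apply: max_poly_roots => //.
  by apply/allP=> x; rewrite mem_enum inE.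
exact: enum_uniq.
Qed.

(* Vanishes at [tr x] as soon as some [b_j] does, where [x ^+ j = a_j + b_j x] and
   [2 <= j <= 5]. *)
Definition small_order_poly : {poly F} :=
  'X * ('X ^+ 2 - 1%:P) * ('X ^+ 2 - 2%:R%:P) * ('X ^+ 4 - 3%:R%:P * 'X ^+ 2 + 1%:P).

Lemma small_order_root x j : x \in SL2 p -> nonscalar (m x) ->
  (0 < j < 6)%N -> (x ^+ j)%g \in Z -> root small_order_poly (\tr (m x)).
Proof.
move=> Gx nx j6; rewrite mem_center ?groupX // valX.
set t := \tr (m x); have d := det_SL2 Gx.
have e2 := SL2_exp2 d; have e3 := SL2_expS d e2; have e4 := SL2_expS d e3.
have e5 := SL2_expS d e4; rewrite -/t in e2 e3 e4 e5.
have b0 a b : ~~ nonscalar (a%:M + b *: m x) -> b = 0.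
  by rewrite nonscalar_span nx andbT negbK => /eqP.
rewrite rootE !(hornerM, hornerD, hornerN, hornerX, hornerC, horner_exp).
have [j1|[j2|[j3|[j4|j5]]]] : (j = 1 \/ j = 2 \/ j = 3 \/ j = 4 \/ j = 5)%N by lia.
- by rewrite j1 expr1 nx.
- by rewrite j2 e2 => /b0 ->; rewrite !mul0r.
- rewrite j3 e3 => /b0 e; apply/eqP.
  transitivity ((-1 + t * t) * (t * (t ^+ 2 - 2%:R) * (t ^+ 4 - 3%:R * t ^+ 2 + 1))).
    by ring.
  by rewrite e mul0r.
- rewrite j4 e4 => /b0 e; apply/eqP.
  transitivity ((- t + (-1 + t * t) * t) * ((t ^+ 2 - 1) * (t ^+ 4 - 3%:R * t ^+ 2 + 1))).
    by ring.
  by rewrite e mul0r.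
rewrite j5 e5 => /b0 e; apply/eqP.
transitivity ((- (-1 + t * t) + (- t + (-1 + t * t) * t) * t) *
  (t * (t ^+ 2 - 1) * (t ^+ 2 - 2%:R))); first by ring.
by rewrite e mul0r.
Qed.

Lemma small_order_poly_size :
  small_order_poly != 0 /\ (size small_order_poly <= 10)%N.
Proof.
have m1 (q r : {poly F}) : (size r < size q)%N -> q \is monic -> q + r \is monic.
  by move=> lt; rewrite !monicE lead_coefDl.
have sz2 (c : F) : size ('X ^+ 2 - c%:P) = 3%N by rewrite size_polyDl ?size_polyXn //
  size_polyN size_polyC; case: eqP.
have mo2 (c : F) : 'X ^+ 2 - c%:P \is monic.
  by apply: m1; rewrite ?monicXn // size_polyN size_polyC size_polyXn; case: eqP.
have sz4' : (size (1%:P - 3%:R%:P * 'X ^+ 2 : {poly F})%R < 5)%N.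
  rewrite (leq_ltn_trans (size_polyD _ _)) // gtn_max size_polyC oner_neq0 size_polyN.
  by rewrite (leq_ltn_trans (size_polyMleq _ _)) // size_polyXn size_polyC; case: eqP.
have E4 : 'X ^+ 4 - 3%:R%:P * 'X ^+ 2 + 1%:P = 'X ^+ 4 + (1%:P - 3%:R%:P * 'X ^+ 2) :> {poly F}.
  by rewrite -addrA [- _ + _]addrC.
have sz4 : size ('X ^+ 4 - 3%:R%:P * 'X ^+ 2 + 1%:P : {poly F}) = 5%N.
  by rewrite E4 size_polyDl size_polyXn.
have mo4 : 'X ^+ 4 - 3%:R%:P * 'X ^+ 2 + 1%:P \is @monic F.
  by rewrite E4; apply: m1; rewrite ?monicXn // size_polyXn.
have moA : 'X * ('X ^+ 2 - 1%:P) \is @monic F by rewrite monicMr // monicX.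
have moB : 'X * ('X ^+ 2 - 1%:P) * ('X ^+ 2 - 2%:R%:P) \is @monic F by rewrite monicMr.
have mon : small_order_poly \is monic by rewrite monicMr.
split; first exact: monic_neq0.
rewrite size_Mmonic ?monic_neq0 // size_Mmonic ?monic_neq0 // size_Mmonic ?monic_neq0 ?monicX //.
by rewrite size_polyX !sz2 sz4.
Qed.

End Generation.

Section Generation.
Variable p : nat.
Hypothesis p_pr : prime p.
Local Notation F := 'F_p.
Local Notation G := (SL2_group p).
Local Notation Z := ('Z(SL2 p))%g.
Local Notation m := (@GLval 2 F).
Implicit Types (g u x y : {'GL_2(p)}) (v w : 'rV[F]_2).

Lemma fixes_cross v u : fixes v u -> cross v (v *m m u) = 0.
Proof. by move/fixesP=> [k ->]; rewrite crossZr cross_vv mulr0. Qed.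

Section Cover.
Variable g : {'GL_2(p)}.
Hypotheses (Gg : g \in SL2 p) (nZg : g \notin Z).

Let ng : nonscalar (m g). Proof. by move: nZg; rewrite mem_center // negbK. Qed.

(** Its roots [s] are the slopes of the lines spanned by (1, s) that [g] preserves. The remaining
    line, spanned by (0, 1), is treated apart. *)
Definition line_poly : {poly F} :=
  (m g 0 1)%:P + (m g 1 1 - m g 0 0)%:P * 'X - (m g 1 0)%:P * 'X ^+ 2.

Lemma line_poly_size : line_poly != 0 /\ (size line_poly <= 3)%N.
Proof.
split; last first.
  apply/leq_sizeP => -[|[|[|j]]] // _.
  by rewrite coefB coefD !coefCM coefC coefX coefXn /= !mulr0 !addr0 subr0.
apply/eqP => /polyP e.
have e0 : m g 0 1 = 0.
  have := e 0%N; rewrite coefB coefD !coefCM coefC coefX coefXn coef0 /=.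
  by rewrite !mulr0 addr0 subr0.
have e1 : m g 1 1 = m g 0 0.
  have := e 1%N; rewrite coefB coefD !coefCM coefC coefX coefXn coef0 /=.
  by rewrite mulr0 mulr1 add0r subr0 => /eqP; rewrite subr_eq0 => /eqP.
have e2 : m g 1 0 = 0.
  have := e 2%N; rewrite coefB coefD !coefCM coefC coefX coefXn coef0 /=.
  by rewrite mulr0 mulr1 add0r sub0r => /eqP; rewrite oppr_eq0 => /eqP.
by move: ng; rewrite /nonscalar e0 e1 e2 !eqxx.
Qed.

(* [x] and [g] fix a common line; [x] is scalar; [x ^+ j] is central for some
   [j < 6]; [x] commutes with [g]; [g] inverts [x]. *)
Definition bad_cover : {set {'GL_2(p)}} :=
  linear_section (0, 0, 1, 0) 0 :|:
  \bigcup_(s in [set s | root line_poly s]) linear_section (- s, 1, - s ^+ 2, s) 0 :|: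
  linear_section (0, 1, 0, 0) 0 :|:
  \bigcup_(t in [set t | root (small_order_poly p) t]) linear_section (1, 0, 0, 1) t :|:
  (if (0, m g 1 0, - m g 0 1, 0) == (0, 0, 0, 0) :> F * F * F * F then set0 else
     linear_section (0, m g 1 0, - m g 0 1, 0) 0) :|:
  linear_section (m g 0 0, m g 1 0, m g 0 1, - m g 0 0) 0.

(** 15 = 1 + 2 + 1 + 9 + 1 + 1 sections: 2 and 9 bound the numbers of roots of [line_poly] and
    [small_order_poly]. *)
Lemma card_bad_cover : (#|bad_cover| <= 15 * (2 * p ^ 2))%N.
Proof.
have [lp0 lp3] := line_poly_size; have [sp0 sp10] := small_order_poly_size p.
have b1 : (#|linear_section (p := p) (0, 0, 1, 0)%R 0%R| <= 1 * (2 * p ^ 2))%N.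
  by rewrite mul1n card_linear_section // !xpair_eqE oner_eq0 !andbF.
have b2 : (#|\bigcup_(s in [set s | root line_poly s])
    linear_section (- s, 1, - s ^+ 2, s)%R 0%R| <= 2 * (2 * p ^ 2))%N.
  apply: leq_trans (card_bigcup_le _ (n := (2 * p ^ 2)%N) _) _ => [s|].
    by rewrite card_linear_section // !xpair_eqE oner_eq0 !andbF.
  rewrite leq_mul2r; apply/orP; right; apply: leq_trans (root_count lp0) _.
  by case: (size _) lp3.
have b3 : (#|linear_section (p := p) (0, 1, 0, 0)%R 0%R| <= 1 * (2 * p ^ 2))%N.
  by rewrite mul1n card_linear_section // !xpair_eqE oner_eq0 !andbF.
have b4 : (#|\bigcup_(t in [set t | root (small_order_poly p) t])
    linear_section (1, 0, 0, 1)%R t| <= 9 * (2 * p ^ 2))%N.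
  apply: leq_trans (card_bigcup_le _ (n := (2 * p ^ 2)%N) _) _ => [s|].
    by rewrite card_linear_section // !xpair_eqE oner_eq0 !andbF.
  rewrite leq_mul2r; apply/orP; right; apply: leq_trans (root_count sp0) _.
  by case: (size _) sp10.
have b5 : (#|(if (0, m g 1 0, - m g 0 1, 0) == (0, 0, 0, 0) :> F * F * F * F then set0 else
     linear_section (0, m g 1 0, - m g 0 1, 0) 0)%R| <= 1 * (2 * p ^ 2))%N.
  by case: eqP => [_|/eqP nz]; rewrite ?cards0 // mul1n card_linear_section.
have b6 : (#|linear_section (m g 0 0, m g 1 0, m g 0 1, - m g 0 0)%R 0%R| <= 1 * (2 * p ^ 2))%N.
  rewrite mul1n card_linear_section // !xpair_eqE; apply/negP.
  move=> /andP[/andP[/andP[/eqP e00 /eqP e10] /eqP e01] _].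
  have := det_SL2 Gg; rewrite det_mx2 e00 e10 mul0r mulr0 subr0 => /eqP.
  by rewrite eq_sym oner_eq0.
rewrite /bad_cover.
rewrite [X in (_ <= X)%N](_ : _ = 1 * (2 * p ^ 2) + 2 * (2 * p ^ 2) + 1 * (2 * p ^ 2) +
  9 * (2 * p ^ 2) + 1 * (2 * p ^ 2) + 1 * (2 * p ^ 2))%N; last by lia.
by do 5![apply: leq_trans (leq_card_setU _ _) _; apply: leq_add => //].
Qed.

Lemma mem_fixes_cover v x : v != 0 -> x \in SL2 p -> fixes v x -> fixes v g ->
  x \in bad_cover.
Proof.
move=> v0 Gx /fixes_cross + /fixes_cross; rewrite !cross_mulE => hx hg.
have [v00|v00] := eqVneq (v 0 0) 0.
  have v01 : v 0 1 != 0 by apply: contra v0 => /eqP v01; apply/eqP/rv2P; rewrite mxE.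
  have M : x \in linear_section (0, 0, 1, 0) 0.
    rewrite inE Gx /= !mul0r mul1r !add0r addr0.
    move: hx; rewrite v00 expr0n /= !mul0r oppr0 !mul0r add0r addr0 sub0r.
    by move/eqP; rewrite oppr_eq0 mulf_eq0 expf_eq0 /= (negPf v01) /= => ->.
  by rewrite !in_setU M.
have v02 : v 0 0 ^+ 2 != 0 by rewrite expf_neq0.
pose s := v 0 1 / v 0 0; have ev : v 0 1 = s * v 0 0 by rewrite divfK.
have M : x \in \bigcup_(s in [set s | root line_poly s]) linear_section (- s, 1, - s ^+ 2, s) 0.
  apply/bigcupP; exists s.
    rewrite inE /line_poly rootE !(hornerM, hornerD, hornerN, hornerX, hornerC, horner_exp).
    apply/eqP; apply: (mulfI v02); apply: (lincomb1 (k := 1) _ hg).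
    by rewrite ev; ring.
  rewrite inE Gx /=; apply/eqP; apply: (mulfI v02); apply: (lincomb1 (k := 1) _ hx).
  by rewrite ev; ring.
by rewrite !in_setU M ?orbT.
Qed.

(** Let [H] be generated by [x], [g] and the centre. If [p] divides |H|, a line is preserved.
    Otherwise projective order at least 6 of [x] rules out the exceptional centralizers of index 4
    and 5 over [Z], so [g] normalizes C_H[x] and sends [x] to itself or its inverse. *)
Lemma mem_bad_cover x : x \in SL2 p -> <<[set x; g]>>%g != SL2 p -> x \in bad_cover.
Proof.
move=> Gx ngen; set A := [set x; g] in ngen.
have sAG : A \subset SL2 p by apply/subsetP=> y /set2P[] ->.
pose H := [group of <<A :|: Z>>%g].
have sHG : H \subset SL2 p by rewrite (gen_subG _ G) subUset sAG; exact: subsetIl.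
have sZH : Z \subset H by rewrite sub_gen // subsetUr.
have Hx : x \in H by rewrite mem_gen // !inE eqxx.
have Hg : g \in H by rewrite mem_gen // !inE eqxx orbT.
have nHG : ~~ (SL2 p \subset H).
  by apply: contra ngen => sGH; apply/eqP/(gen_mul_center p_pr sAG sGH).
have [dv|ndv] := boolP (p %| #|H|)%N.
  have [sGH|[v v0 sHv]] := SL2_subgroup_dvdp p_pr sHG dv; first by rewrite sGH in nHG.
  have fx := subsetP sHv x Hx; have fg := subsetP sHv g Hg.
  rewrite inE in fx; rewrite inE in fg.
  exact: (mem_fixes_cover v0 Gx fx fg).
have [Zx|nZx] := boolP (x \in Z).
  move: Zx; rewrite mem_center // => /nonscalarPn e.
  have M : x \in linear_section (0, 1, 0, 0) 0.
    by rewrite inE Gx e !mxE /= !(mulr0, mul0r, addr0).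
  by rewrite !in_setU M ?orbT.
have nx : nonscalar (m x) by move: nZx; rewrite mem_center // negbK.
have [/existsP[j /andP[j0 jZ]]|/existsPn nj] :=
  boolP [exists j : 'I_6, (0 < j)%N && ((x ^+ j)%g \in Z)].
  have M : x \in \bigcup_(t in [set t | root (small_order_poly p) t]) linear_section (1, 0,
    0, 1) t.
    apply/bigcupP; exists (\tr (m x)).
      by rewrite inE (small_order_root p_pr Gx nx (j := j)) // j0 ltn_ord.
    by rewrite inE Gx /= mxtrace2 !mul1r !mul0r !addr0.
  by rewrite !in_setU M ?orbT.
have C6 : (6 * #|Z| <= #|'C_H[x]%g|)%N.
  apply: leq_card_cent1 => // j /andP[j0 j6]; have := nj (Ordinal j6).
  by rewrite /= j0.
have HxZ : x \in H :\: Z by rewrite inE nZx.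
have zgt0 : (0 < #|Z|)%N by rewrite cardG_gt0.
have nH : H \subset 'N('C_H[x])%g.
  case: (SL2_trichotomy p_pr sHG sZH ndv HxZ) => //; last 2 first.
  - by case=> c4 _; exfalso; move: C6; rewrite c4 leq_pmul2r.
  - by case=> c4 _; exfalso; move: C6; rewrite c4 leq_pmul2r.
  by apply: leq_trans C6; rewrite leq_pmul2r.
have /setIP[_ cxg] : (x ^ g)%g \in 'C_H[x]%g.
  have /normP <- := subsetP nH g Hg; rewrite memJ_conjg inE Hx; exact: cent1id.
have t4 := SL2_trace_coprime p_pr sHG ndv Hx nx.
case: (cent1_trace Gx nx t4 (groupJ Gx Gg) cxg (tr_conj _ _)) => e.
  have : m (x * g)%g = m (g * x)%g by rewrite conjgC e.
  rewrite !valM => /matrixP ec.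
  (* For diagonal [g] the equation read off at (0, 0) is void; but then the diagonal entries of [g]
     differ, and commuting forces [x 0 1 = 0]. *)
  have [g0|g0] := boolP ((0, m g 1 0, - m g 0 1, 0) == (0, 0, 0, 0) :> F * F * F * F).
    move: g0; rewrite !xpair_eqE eqxx /= andbT oppr_eq0 => /andP[/eqP g10 /eqP g01].
    suff M : x \in linear_section (0, 1, 0, 0) 0 by rewrite !in_setU M ?orbT.
    rewrite inE Gx !(mulr0, mul0r, addr0, add0r, mul1r) /=.
    have := ec 0 1; rewrite !mulmx2E g01 mulr0 add0r mul0r addr0 => /eqP.
    rewrite mulrC -subr_eq0 -mulrBl mulf_eq0 subr_eq0 => /orP[/eqP e11|//].
    by move: ng; rewrite /nonscalar g01 g10 e11 !eqxx.
  suff M : x \in linear_section (0, m g 1 0, - m g 0 1, 0) 0.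
    by rewrite !in_setU (negPf g0) M ?orbT.
  rewrite inE Gx /=; apply/eqP.
  by have := ec 0 0; rewrite !mulmx2E => ec0; apply: (lincomb1 (k := 1) _ ec0); ring.
(* As x^-1 = tr x - x is linear in [x], being inverted by [g] is a linear condition. *)
have : m (x * g)%g = m (g * x^-1)%g by rewrite conjgC e.
rewrite !valM SL2_invE // => /matrixP ec.
rewrite in_setU; apply/orP; right; rewrite inE Gx; apply/eqP.
have := ec 0 0; rewrite !mulmx2E !mxE /= mxtrace2 => ec0.
by apply: (lincomb1 (k := 1) _ ec0); ring.
Qed.

End Cover.

(** From p = 61 on, |SL(2, p)| is at least 60 p^2, twice the size of the bad cover. Below 61 one
    cogenerator suffices, since the group has at most 61^4 elements. *)
Lemma card_cogenerators g : g \in SL2 p -> g \notin Z ->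
  (#|SL2 p| <= 61 ^ 4 * #|[set x in SL2 p | <<[set x; g]>>%g == SL2 p]|)%N.
Proof.
move=> Gg nZg; set A := finset _.
have [small|large] := ltnP p 61.
  have [x Gx gx] := exists_cogenerator Gg nZg.
  have A0 : (0 < #|A|)%N by apply/card_gt0P; exists x; rewrite inE Gx gx eqxx.
  rewrite (leq_trans (card_SL2_le p_pr)) // (@leq_trans (61 ^ 4)) //.
    by rewrite leq_exp2r // ltnW.
  by rewrite leq_pmulr.
have sub : SL2 p \subset A :|: bad_cover g.
  apply/subsetP=> x Gx; rewrite in_setU inE Gx /=.
  by case: eqP => //= /eqP ngen; apply: mem_bad_cover.
have := subset_leq_card sub; have := card_bad_cover Gg nZg.
have := (leq_card_setU A (bad_cover g)).1; have := card_SL2_ge p_pr.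
set a := #|A|; set b := #|bad_cover g|; set c := #|_ :|: _|; set s := #|SL2 p|.
move=> h1 h2 h3 h4; have h5 : (60 * p ^ 2 <= s)%N.
  by apply: leq_trans h1; rewrite leq_mul2r; apply/orP; right; lia.
have : (2 * a <= 61 ^ 4 * a)%N by rewrite leq_mul2r orbT.
apply: leq_trans.
clear -h2 h3 h4 h5; set q := (p ^ 2)%N in h3 h5; clearbody a b c s q; lia.
Qed.

End Generation.

Lemma SL2_cogenerators : exists N, forall p (g : {'GL_2(p)}), prime p ->
  g \in SL2 p -> g \notin ('Z(SL2 p))%g ->
  (#|SL2 p| <= N * #|[set x in SL2 p | <<[set x; g]>>%g == SL2 p]|)%N.
Proof. by exists (61 ^ 4)%N => p g p_pr; apply: card_cogenerators. Qed.

(** * Redundant generating tuples of SL(2, p) *)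

Section Irredundant.
Variables (p k : nat).
Hypotheses (p_pr : prime p) (k4 : (4 <= k)%N).
Local Notation F := 'F_p.
Local Notation G := (SL2_group p).
Local Notation Z := ('Z(SL2 p))%g.
Local Notation m := (@GLval 2 F).
Implicit Types (g u x y : {'GL_2(p)}) (v w : 'rV[F]_2).

Lemma SL2_no_fixed_line v : v != 0 -> ~~ (SL2 p \subset line_stab v).
Proof.
move=> v0; pose w : 'rV[F]_2 := \row_j (if j == 0 then - v 0 1 else v 0 0).
have [v00|v00] := eqVneq (v 0 0) 0.
  have v01 : v 0 1 != 0 by apply: contra v0 => /eqP v01; apply/eqP/rv2P; rewrite mxE.
  have [x Gx ex] := transvec_lift (\row_j (j == 0)%:R : 'rV[F]_2) 1.
  apply/subsetPn; exists x => //; rewrite inE; apply/negP => /fixes_cross.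
  rewrite ex mul_transvec crossDr crossZr cross_vv add0r /cross !mxE v00 /=.
  move/eqP; rewrite !mul1r !(mulr1, mulr0, mul0r) !subr0 sub0r mulrN oppr_eq0.
  by rewrite mulf_eq0 (negPf v01).
have [x Gx ex] := transvec_lift (\row_j (j == 1)%:R : 'rV[F]_2) 1.
apply/subsetPn; exists x => //; rewrite inE; apply/negP => /fixes_cross.
rewrite ex mul_transvec crossDr crossZr cross_vv add0r /cross !mxE /=.
move/eqP; rewrite !mul1r !(mulr1, mulr0, mul0r) !sub0r subr0 mulNr oppr_eq0.
by rewrite mulf_eq0 (negPf v00).
Qed.

Lemma p_dvd_SL2 : (p %| #|SL2 p|)%N.
Proof.
have [x Gx ex] := transvec_lift (\row_j (j == 0)%:R : 'rV[F]_2) 1.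
have := order_dvdG (G := G) Gx; rewrite (order_transvec p_pr _ _ ex) ?oner_neq0 //.
by apply/eqP=> /rowP/(_ 0); rewrite !mxE => /eqP; rewrite oner_eq0.
Qed.

Lemma SL2_nonabelian x : x \in SL2 p -> nonscalar (m x) -> ~~ (SL2 p \subset 'C_(SL2 p)[x])%g.
Proof.
move=> Gx nx; apply/negP; rewrite subsetI subxx /= => sub.
by move: (nx); apply/negP; rewrite -mem_center // inE Gx -sub_cent1.
Qed.

Lemma SL2_not_abelian : ~~ abelian (SL2 p).
Proof.
have [x Gx ex] := transvec_lift (\row_j (j == 0)%:R : 'rV[F]_2) 1.
have nx : nonscalar (m x).
  by rewrite ex /nonscalar !transvecE !mxE /= !(mul1r, mulr1, add0r) orbT.
apply: contra (SL2_nonabelian Gx nx) => cGG; rewrite subsetI subxx sub_cent1.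
exact: (subsetP cGG).
Qed.

(** If [p] divides the order of the normal centralizer, it contains two transvections along
    different lines and is everything. Otherwise its index is at most 2 yet divisible by [p], so p =
    2; then [x] has trace 1 and x^3 is central. *)
Lemma SL2_not_norm_cent1 x : x \in SL2 p -> nonscalar (m x) ->
    (p %| #[x]%g)%N || ((x ^+ 2)%g \notin Z) && ((x ^+ 3)%g \notin Z) ->
  ~~ (SL2 p \subset 'N('C_(SL2 p)[x]))%g.
Proof.
move=> Gx nx good; apply/negP => sGN; pose C := [group of ('C_(SL2 p)[x])%g].
have sCG : C \subset SL2 p by apply: subsetIl.
have [dv|ndv] := boolP (p %| #|C|)%N.
  have [u Cu ou] := Cauchy p_pr dv; have Gu := subsetP sCG u Cu.
  have [v [s [v0 s0 e]]] := order_p_transvec p_pr Gu ou.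
  have /subsetPn[h Gh] := SL2_no_fixed_line v0; rewrite inE => nfix.
  have Cuh : (u ^ h)%g \in C by rewrite -mem_conjgV (normP _) // groupV (subsetP sGN).
  have sGC : SL2 p \subset C.
    apply: (SL2_gen_transvec Cu Cuh e (transvec_conj Gh e) s0 s0).
    apply: contra nfix => /eqP /(cross_eq0 v0)[l el]; apply/fixesP; by exists l.
  by move: sGC; apply/negP; apply: SL2_nonabelian.
have xC : x \in C by rewrite inE Gx cent1id.
have ndx : ~~ (p %| #[x]%g)%N.
  by apply: contra ndv => dx; apply: dvdn_trans dx (order_dvdG xC).
rewrite (negPf ndx) /= in good; case/andP: good => nx2 nx3.
have t4 : \tr (m x) ^+ 2 != 4%:R.
  by apply: contra ndx => /eqP; apply: order_p_trace.
have := SL2_cent1_index (subxx (SL2_group p)) Gx nx t4.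
rewrite (setIidPl sGN) => idx.
have := p_dvd_SL2; rewrite -(Lagrange sCG) Euclid_dvdM // (negPf ndv) /= => dvi.
have p2 : p = 2%N.
  apply/eqP; rewrite eqn_leq prime_gt1 // andbT (leq_trans _ idx) // dvdn_leq //.
have e2 : 2%:R = 0 :> F by apply/eqP; rewrite Fp_two_eq0 // p2.
set t := \tr (m x) in t4; have d := det_SL2 Gx.
have E2 := SL2_exp2 d; have E3 := SL2_expS d E2.
have t0 : t != 0.
  by apply: contra t4 => /eqP ->; rewrite expr0n /= (natrM _ 2 2) e2 mulr0.
have t1 : t = 1.
  have := expf_card t; rewrite (etrans (card_Fp p_pr) p2).
  by rewrite expr2 -[RHS]mulr1 => /(mulfI t0).
move/negP: nx3; apply; rewrite mem_center ?groupX // valX E3 nonscalar_span.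
by rewrite -/t t1 mulr1 addNr eqxx.
Qed.

Section Tuple.
Variable t : {ffun 'I_k -> {'GL_2(p)}}.
Hypotheses (Gt : t \in generating_tuples k (SL2 p))
           (irr : forall i, ~~ redundant_at G i t).

Let memG i : t i \in SL2 p. Proof. exact: (generating_mem (G := G) i Gt). Qed.

(** The centre is included as the trichotomy demands; by [gen_mul_center] this does not change which
    sets of entries generate. *)
Definition subgen (I : {set 'I_k}) := [group of <<(t @: I) :|: Z>>%g].

Lemma subgen_sub (I : {set 'I_k}) : subgen I \subset SL2 p.
Proof.
rewrite (gen_subG _ G) subUset; apply/andP; split; last exact: subsetIl.
by apply/subsetP=> _ /imsetP[i _ ->]; apply: memG.
Qed.

Lemma mem_subgen (I : {set 'I_k}) i : i \in I -> t i \in subgen I.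
Proof. by move=> Ii; rewrite mem_gen // inE imset_f. Qed.

Lemma center_subgen (I : {set 'I_k}) : Z \subset subgen I.
Proof. by rewrite sub_gen // subsetUr. Qed.

Lemma subgen_sup (I : {set 'I_k}) (H : {group {'GL_2(p)}}) :
  {in I, forall i, t i \in H} -> Z \subset H -> subgen I \subset H.
Proof.
move=> tH ZH; rewrite gen_subG subUset ZH andbT.
by apply/subsetP=> _ /imsetP[i Ii ->]; apply: tH.
Qed.

Lemma SL2_subgenT : SL2 p \subset subgen setT.
Proof.
have /generating_tuplesP <- := Gt; apply: genS.
by apply: subset_trans (subsetUl _ _); apply/subsetP=> _ /imsetP[i _ ->]; rewrite imset_f.
Qed.

Lemma subgen_proper (I : {set 'I_k}) i : i \notin I -> ~~ (SL2 p \subset subgen I).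
Proof.
move=> nIi; apply: contra (irr i) => sGH; rewrite /redundant_at eqEsubset; apply/andP; split.
  by rewrite (gen_subG _ G); apply/subsetP=> _ /imsetP[j _ ->]; apply: memG.
have e : <<t @: I>>%g = SL2 p.
  apply: gen_mul_center => //; by apply/subsetP=> _ /imsetP[j _ ->]; apply: memG.
rewrite /= -e; apply: genS; apply/subsetP=> _ /imsetP[j Ij ->]; apply/imsetP; exists j => //.
by rewrite inE; apply: contraNneq nIi => <-.
Qed.

Lemma subgen_not_mem (I : {set 'I_k}) i j : i \notin I -> i != j -> j \in I ->
  ~~ (t i \in subgen I).
Proof.
move=> nIi ij Ij; apply/negP => ti; have := @subgen_proper (~: [set i]) i.
rewrite !inE eqxx => /(_ isT)/negP; apply; apply: subset_trans SL2_subgenT _.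
apply: subgen_sup (center_subgen _) => l _; have [->|li] := eqVneq l i; last first.
  by rewrite mem_subgen // !inE.
apply: (subsetP (subgen_sup _ (center_subgen _)) _ ti) => n nI; rewrite mem_subgen // !inE.
by apply: contraNneq nIi => <-.
Qed.

Lemma irredundant_nonscalar i : nonscalar (m (t i)).
Proof.
rewrite -[nonscalar _]negbK -mem_center //; apply/negP => Zi.
have := @subgen_proper (~: [set i]) i.
rewrite !inE eqxx => /(_ isT)/negP; apply; apply: subset_trans SL2_subgenT _.
apply: subgen_sup (center_subgen _) => l _; have [->|li] := eqVneq l i; last first.
  by rewrite mem_subgen // !inE.
exact: (subsetP (center_subgen _)).
Qed.

Lemma ord_avoid (I : {set 'I_k}) : (#|I| < k)%N -> exists i, i \notin I.
Proof.
move=> lt; have : (0 < #|~: I|)%N by rewrite cardsCs setCK card_ord subn_gt0.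
by case/card_gt0P=> i; rewrite inE; exists i.
Qed.

Section Good.
Variable i : 'I_k.
Hypothesis good : (p %| #[t i]%g)%N || (((t i ^+ 2)%g \notin Z) && ((t i ^+ 3)%g \notin Z)).
Local Notation x := (t i).
Let nx := irredundant_nonscalar i.

Definition normalizing g := ((x ^ g)%g \in 'C[x])%g.

Lemma good_card_cent1 (H : {group {'GL_2(p)}}) : H \subset SL2 p -> Z \subset H ->
  x \in H -> ~~ (p %| #|H|)%N -> (4 * #|Z| <= #|'C_H[x]%g|)%N.
Proof.
move=> sHG sZH Hx ndv; apply: leq_card_cent1 => // j j4.
have [j1|[j2|j3]] : (j = 1 \/ j = 2 \/ j = 3)%N by clear -j4; lia.
- by rewrite j1 expg1 mem_center // negbK.
- case/orP: good => [dx|/andP[]]; last by rewrite j2.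
  by case/negP: ndv; apply: dvdn_trans dx (order_dvdG Hx).
case/orP: good => [dx|/andP[]]; last by rewrite j3.
by case/negP: ndv; apply: dvdn_trans dx (order_dvdG Hx).
Qed.

Lemma norm_normalizing (H : {group {'GL_2(p)}}) g : x \in H ->
  H \subset 'N('C_H[x])%g -> g \in H -> normalizing g.
Proof.
move=> Hx sHN Hg; suff /setIP[] : (x ^ g)%g \in 'C_H[x]%g by [].
have /normP e := subsetP sHN g Hg.
have : (x ^ g)%g \in ('C_H[x] :^ g)%g by rewrite memJ_conjg inE Hx cent1id.
by rewrite e.
Qed.

(* The exceptional subgroups of the trichotomy are excluded because their order
   is determined by that of the centralizer: two entries would already generate
   the group generated by three. *)
Lemma pair_dichotomy j l : i != j -> i != l -> j != l ->
  (exists2 v, v != 0 & [/\ fixes v x, fixes v (t j) & fixes v (t l)]) \/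
  (normalizing (t j) /\ normalizing (t l)).
Proof.
move=> ij il jl; pose I := [set i; j; l]; pose H := subgen I.
(* A fourth index exists because [k] is at least 4; its irredundancy makes [H] proper. *)
have [n nIn] : exists n, n \notin I.
  apply: ord_avoid; apply: leq_trans k4; rewrite ltnS.
  apply: leq_trans (leq_card_setU _ _) _; rewrite cards1 addn1 ltnS.
  by rewrite cards2; case: (_ != _).
have [Ii [Ij Il]] : i \in I /\ j \in I /\ l \in I by rewrite !inE !eqxx !orbT.
have nGH := subgen_proper nIn.
have [dv|ndv] := boolP (p %| #|H|)%N.
  left; have [sGH|[v v0 /subsetP sHv]] := SL2_subgroup_dvdp p_pr (subgen_sub I) dv.
    by rewrite sGH in nGH.
  exists v => //; have mv q : q \in I -> fixes v (t q).
    by move=> Iq; have := sHv _ (mem_subgen Iq); rewrite inE.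
  by split; apply: mv.
right; have Hx : x \in H by apply: mem_subgen.
have C4 := good_card_cent1 (subgen_sub I) (center_subgen I) Hx ndv.
have HxZ : x \in H :\: Z by rewrite inE Hx mem_center // negbK nx.
have zgt0 : (0 < #|Z|)%N by rewrite cardG_gt0.
have tri := SL2_trichotomy p_pr (subgen_sub I) (center_subgen I) ndv HxZ C4.
have key q q' : q \in I -> q' \in I -> q' \notin [set i; q] ->
    (#|'C_H[x]%g| = (4 * #|Z|)%N /\ #|H| = (24 * #|Z|)%N) \/
    (#|'C_H[x]%g| = (5 * #|Z|)%N /\ #|H| = (60 * #|Z|)%N) -> normalizing (t q).
  move=> Iq Iq' nq' cardH; pose J := [set i; q]; pose K := subgen J.
  have sKH : K \subset H.
    apply: subgen_sup (center_subgen _) => r; rewrite !inE.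
    by case/orP=> /eqP->; apply: mem_subgen.
  have Jq : q \in J by rewrite !inE eqxx orbT.
  have Kx : x \in K by apply: mem_subgen; rewrite !inE eqxx.
  have ndvK : ~~ (p %| #|K|)%N by apply: contra ndv => /dvdn_trans; apply; apply: cardSg.
  have KxZ : x \in K :\: Z by rewrite inE Kx mem_center // negbK nx.
  have C4K := good_card_cent1 (subgen_sub J) (center_subgen J) Kx ndvK.
  (* As 4 and 5 do not divide each other, an exceptional [K] has the type and hence the order of
     [H]; then K = H, although the third entry is not in [K]. *)
  have dC : (#|'C_K[x]%g| %| #|'C_H[x]%g|)%N by apply: cardSg; apply: setSI.
  have nKH : #|K| <> #|H|.
    move=> eKH; have/eqP eK : K :==: H by rewrite eqEcard sKH eKH leqnn.
    have := @subgen_not_mem J q' i nq'.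
    rewrite (_ : q' != i); last by apply: contraNneq nq' => ->; rewrite !inE eqxx.
    rewrite (_ : i \in J); last by rewrite !inE eqxx.
    by move=> /(_ isT isT); rewrite -/K eK mem_subgen.
  case: (SL2_trichotomy p_pr (subgen_sub J) (center_subgen J) ndvK KxZ C4K).
  - by move=> sKN; apply: norm_normalizing Kx sKN (mem_subgen Jq).
  - case=> cK K24; case: cardH => -[cH H60]; first by case: nKH; rewrite K24 H60.
    by move: dC; rewrite cK cH dvdn_pmul2r.
  case=> cK K24; case: cardH => -[cH H60]; last by case: nKH; rewrite K24 H60.
  by move: dC; rewrite cK cH dvdn_pmul2r.
have nlij : l \notin [set i; j] by rewrite !inE negb_or eq_sym il eq_sym jl.
have njil : j \notin [set i; l] by rewrite !inE negb_or eq_sym ij jl.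
case: tri => [sHN|c|c].
- by split; apply: norm_normalizing Hx sHN (mem_subgen _).
- by split; [apply: (key j l) | apply: (key l j)] => //; left.
by split; [apply: (key j l) | apply: (key l j)] => //; right.
Qed.

(** If every entry carries [x] into its centralizer, all of SL(2, p) normalizes that centralizer. If
    [t j] does not, then [x], [t j] and any third entry share a line. A third entry moving the first
    such line gives a second one, and [x], [t j], diagonal in the basis so obtained, commute. *)
Lemma irredundant_not_good : False.
Proof.
have /negP := SL2_not_norm_cent1 (memG i) nx good; apply.
suff N j : normalizing (t j).
  apply: subset_trans SL2_subgenT _.
  have HxG : x \in SL2_group p :\: Z by rewrite inE memG mem_center // negbK nx.
  have cGZ : SL2 p \subset 'C(Z)%g by rewrite centsC subsetIr.
  apply: (subgen_sup (H := [group of 'N('C_(SL2 p)[x])%g])) => [j _|]; last first.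
    by apply: cents_norm; rewrite centsC subIset // cGZ.
  have cZG : Z \subset 'C(SL2_group p)%g by apply: subsetIr.
  have sZG : Z \subset SL2_group p by apply: subsetIl.
  apply/normP; rewrite -(subcent1_conj x (memG j)).
  apply: (subcent1_eq (Z := [group of Z]) _ HxG).
    by move=> y Hy; apply: abelian_cent1; apply: mem_center_sub Hy.
  rewrite inE (center_memJ (Z := [group of Z]) cZG) ?memG // mem_center // negbK nx.
  by apply/setIP; split; [rewrite groupJ | apply: N].
have [->|ji] := eqVneq j i; first by rewrite /normalizing conjgE mulKg cent1id.
apply: contraT => nj.
have [l0] : exists l, l \notin [set i; j].
  by apply: ord_avoid; rewrite cards2; apply: leq_trans k4; case: (_ != _).
rewrite !inE negb_or => /andP[l0i l0j].
rewrite eq_sym in ji; rewrite eq_sym in l0i; rewrite eq_sym in l0j.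
have [[v v0 [fx fj _]]|[]] := pair_dichotomy ji l0i l0j; last by rewrite (negPf nj).
have [m0 nm0] : exists l, ~~ fixes v (t l).
  apply/existsP; rewrite -negb_forall; apply: contra (SL2_no_fixed_line v0) => /forallP fv.
  apply: subset_trans SL2_subgenT _; apply: subgen_sup => [l _|]; first by rewrite inE fv.
  apply/subsetP=> z /center_scalar[a _ e]; rewrite inE; apply/fixesP; exists a.
  by rewrite e mul_mx_scalar.
have m0i : i != m0 by apply: contraNneq nm0 => <-.
have m0j : j != m0 by apply: contraNneq nm0 => <-.
have [[w w0 [gx gj gm]]|[]] := pair_dichotomy ji m0i m0j; last by rewrite (negPf nj).
have D : cross v w != 0.
  apply: contra nm0 => /eqP /(cross_eq0 v0)[c ec]; case/fixesP: gm => d ed.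
  have c0 : c != 0 by apply: contra w0 => /eqP c0; rewrite ec c0 scale0r.
  apply/fixesP; exists d; apply: (scalerI c0).
  by rewrite scalemxAl -ec ed ec !scalerA mulrC.
case/negP: nj; rewrite /normalizing (_ : (x ^ t j)%g = x) ?cent1id //.
apply/conjg_fixP/commgP/cent1P; rewrite cent1C commuteE; apply/eqP.
case/fixesP: fx => a ea; case/fixesP: fj => b eb; case/fixesP: gx => c ec;
  case/fixesP: gj => d ed.
apply: (matrix2_rv D); rewrite !mulmxA.
  by rewrite eb ea -!scalemxAl eb ea !scalerA mulrC.
by rewrite ed ec -!scalemxAl ed ec !scalerA mulrC.
Qed.

End Good.

(** The coefficients of [x] in x^2 and x^3 are t and t^2 - 1, so a central square or cube pins the
    trace. *)
Lemma irredundant_trace i : small_trace (\tr (m (t i))).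
Proof.
have nx := irredundant_nonscalar i.
have [good|] := boolP ((p %| #[t i]%g)%N || (((t i ^+ 2)%g \notin Z) && ((t i ^+ 3)%g \notin Z))).
  by case: (irredundant_not_good good).
rewrite negb_or negb_and !negbK => /andP[ndv p23].
have t4 : \tr (m (t i)) ^+ 2 != 4%:R.
  by apply: contra ndv => /eqP; apply: order_p_trace.
have d := det_SL2 (memG i); have E2 := SL2_exp2 d; have E3 := SL2_expS d E2.
move: p23; rewrite !mem_center ?groupX ?memG // !valX E2 E3 !nonscalar_span nx !andbT !negbK.
case/orP=> /eqP e; [left | right; move/eqP: e; rewrite addrC subr_eq0 -expr2 => /eqP e];
  split=> //.
  by apply: contra t4 => /eqP e2; rewrite e expr0n (natrM _ 2 2) e2 mulr0.
by apply: contra t4 => /eqP e3; rewrite e; apply/eqP; rewrite (natrD _ 3 1) e3 add0r.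
Qed.
End Tuple.

End Irredundant.

(** * Redundancy after six moves *)

Section Near.
Variables (p k : nat).
Hypotheses (p_pr : prime p) (k4 : (4 <= k)%N).
Local Notation F := 'F_p.
Local Notation G := (SL2_group p).
Local Notation m := (@GLval 2 F).
Implicit Types (t : {ffun 'I_k -> {'GL_2(p)}}) (i j l : 'I_k).
Local Notation far_from_redundant := (@far_from_redundant _ k G).

Lemma far_mem n t i : far_from_redundant n t -> t i \in SL2 p.
Proof. by case/andP=> Gt _; apply: (generating_mem (G := G) i Gt). Qed.

Lemma far_trace n t i : far_from_redundant n t -> small_trace (\tr (m (t i))).
Proof.
move=> /(far_leq (leq0n n)) /andP[Gt]; rewrite /= negb_exists => /forallP irr.
exact: (irredundant_trace p_pr k4 Gt irr).
Qed.

(** When both traces are 1 or -1, the identity tr(xy) + tr(xy^-1) = tr x tr y applies; both products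
    are entries one move away, so one has trace 0. *)
Lemma far_trace_zero n t i j : i != j -> far_from_redundant n.+1 t ->
  exists t', [/\ far_from_redundant n t', forall l, l != i -> t' l = t l &
    (\tr (m (t' i)) = 0 \/ \tr (m (t' j)) = 0) /\ 2%:R != 0 :> F].
Proof.
move=> ij ft; have ft0 := far_leq (leqnSn n) ft.
have [[e n2]|[si _]] := far_trace i ft; first by exists t; split=> //; split=> //; left.
have [[e n2]|[sj _]] := far_trace j ft; first by exists t; split=> //; split=> //; right.
have fb b := far_moveR b ij ft.
have mi b : moveR i j b t i = (t i * (if b then (t j)^-1 else t j))%g.
  by rewrite ffunE eqxx.
have := small_trace_split si sj (trace_mul_inv _ _).
rewrite -SL2_invE ?(far_mem _ ft) // -!valM.
have := far_trace i (fb true); have := far_trace i (fb false); rewrite !mi => T1 T2.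
case/(_ T1 T2) => e n2.
have mE b l : l != i -> moveR i j b t l = t l by move=> li; rewrite ffunE (negPf li).
case: e => e.
  by exists (moveR i j false t); split=> //; [apply: mE | rewrite mi; split=> //; left].
by exists (moveR i j true t); split=> //; [apply: mE | rewrite mi; split=> //; left].
Qed.

(** Each word of [trace_obstruction] becomes an entry after right moves; the longest, B C^-1 A C A,
    takes four and fixes the budget. *)
Lemma far_obstruction t a b c : a != b -> a != c -> b != c -> far_from_redundant 4 t ->
  \tr (m (t a)) = 0 -> \tr (m (t b)) = 0 -> 2%:R != 0 :> F -> False.
Proof.
move=> ab ac bc ft ta tb n2.
have ca : c != a by rewrite eq_sym.
have cb : c != b by rewrite eq_sym.
have ba : b != a by rewrite eq_sym.
have mem i : t i \in SL2 p by apply: far_mem ft.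
have det i : \det (m (t i)) = 1 by apply: det_SL2.
have same i j d t' : moveR i j d t' i = (t' i * (if d then (t' j)^-1 else t' j))%g.
  by rewrite ffunE eqxx.
have other i j d t' l : l != i -> moveR i j d t' l = t' l.
  by move=> li; rewrite ffunE (negPf li).
apply: (trace_obstruction ta tb (det a) (det b) (det c) n2); rewrite -?SL2_invE //.
- by have := far_trace a (far_moveR false ab ft); rewrite same.
- exact: far_trace ft.
- by have := far_trace c (far_moveR false ca ft); rewrite same.
- by have := far_trace c (far_moveR false cb ft); rewrite same.
- have := far_trace c (far_moveR false cb (far_moveR false ca ft)).
  by rewrite !same !(other c) //.
- have := far_trace c (far_moveR false ca (far_moveR false cb ft)).
  by rewrite !same !(other c) //.
- have := far_trace c (far_moveR false ca (far_moveR false cb (far_moveR false ca ft))).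
  by rewrite !same !(other c) //.
- have := far_trace b (far_moveR false bc (far_moveR false ba (far_moveR true bc ft))).
  by rewrite !same !(other b) //.
have := far_trace b (far_moveR false ba (far_moveR false bc (far_moveR false ba (far_moveR
  true bc ft)))).
by rewrite !same !(other b) //.
Qed.

Theorem SL2_nearly_redundant t : t \in generating_tuples k (SL2 p) -> nearly_redundant G 6 t.
Proof.
move=> Gt; apply/negPn/negP => nr;
  have ft : far_from_redundant 6 t by rewrite /far_from_redundant Gt.
have k0 : (0 < k)%N by lia.
have k1 : (1 < k)%N by lia.
have k2 : (2 < k)%N by lia.
pose i0 := Ordinal k0; pose i1 := Ordinal k1; pose i2 := Ordinal k2.
have [t1 [f1 e1 [z1 n2]]] := far_trace_zero (i := i0) (j := i1) isT ft.
have [a [b [ab a2 b2 za]]] : exists a b, [/\ a != b, a != i2, b != i2 & \tr (m (t1 a)) = 0].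
  by case: z1 => z; [exists i0, i1 | exists i1, i0].
(* The second move changes entry [b] only, so entry [a] keeps its trace 0 and a partner with trace 0
   is found at [b] or [i2]. *)
have [t2 [f2 e2 [[z2|z2] _]]] := far_trace_zero b2 f1; rewrite -(e2 a ab) in za.
  exact: (far_obstruction ab a2 b2 f2 za z2 n2).
have b2' : i2 != b by rewrite eq_sym.
exact: (far_obstruction a2 ab b2' f2 za z2 n2).
Qed.

End Near.

(* From cardinalities to real expansion coefficients *)
From mathcomp Require Import all_classical all_reals all_analysis.

Lemma expander_card_le (R : realType) (T : finType) (V : {set T}) (e : rel T)
    (c : R) (N : nat) (A : {set T}) :
    0 < c -> c^-1 <= N%:R -> expander V e c ->
    A \subset V -> A != finset.set0 -> (2 * #|A| < #|V|)%N ->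
  (#|A| <= N * #|boundary V e A|)%N.
Proof.
move=> c0 cN exp sAV A0 ltA; have cA : 0 < #|A|%:R :> R by rewrite ltr0n card_gt0.
have : (c%:E <= (expansion_ratio R V e A)%:E)%E.
  by apply: le_trans exp _; apply: ereal_inf_lbound; exists A.
rewrite lee_fin /expansion_ratio ler_pdivlMr // mulrC -ler_pdivlMr // => le.
rewrite -(ler_nat R) natrM; apply: le_trans le _.
by rewrite mulrC ler_wpM2r.
Qed.

(** The successor keeps the expansion constant positive when [N] is 0. *)
Lemma card_le_expander (R : realType) (T : finType) (V : {set T}) (e : rel T) (N : nat) :
    (forall A : {set T}, A \subset V -> A != finset.set0 -> (2 * #|A| < #|V|)%N ->
      (#|A| <= N * #|boundary V e A|)%N) ->
  expander V e (N.+1%:R^-1 : R).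
Proof.
move=> le; apply: le_ereal_inf_tmp => _ [A [sAV A0 ltA ->]].
have cA : 0 < #|A|%:R :> R by rewrite ltr0n card_gt0.
rewrite lee_fin /expansion_ratio ler_pdivlMr // ler_pdivrMl ?ltr0n //.
rewrite -natrM ler_nat; apply: leq_trans (le A sAV A0 ltA) _.
by rewrite leq_mul2r leqnSn orbT.
Qed.

Theorem corollary1p3 (R : realType) (beta0 beta c : R) (p : nat -> nat)
    (k : nat) :
  0 < beta0 ->
  (\forall X \near +oo,
     exists q : nat, prime q /\ X <= q%:R <= X + X `^ beta0) ->
  beta0 < beta < 1 ->
  0 < c ->
  (forall n, prime (p n)) ->
  (forall n, (p n < p n.+1)%N) ->
  (forall n, (p n.+1)%:R <= (p n)%:R + (p n)%:R `^ beta) ->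
  (forall (n : nat) (S : {set {'GL_2(p n)}}),
     symmetric_set S -> <<S>>%g = SL2 (p n) ->
     expander (SL2 (p n)) (cayley_rel S) c) ->
  (4 <= k)%N ->
  exists2 c' : R, 0 < c' &
    forall n, expander (generating_tuples k (SL2 (p n)))
      (@product_replacement_rel {'GL_2(p n)} k) c'.
Proof.
move=> _ _ _ c0 p_pr _ _ exp k4; have [N2 cogen] := SL2_cogenerators.
(* [N], like [N2] and the number 6 of moves, is fixed before [n], which makes the constant uniform
   along the sequence. *)
pose N := Num.bound c^-1.
have cN : c^-1 <= N%:R by apply/ltW/archi_boundP; rewrite invr_ge0 ltW.
exists (expansion_const k N N2 6).+1%:R^-1; first by rewrite invr_gt0 ltr0n.
move=> n; apply: card_le_expander => Y sYV _ ltY.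
apply: (product_replacement_isoperimetry (G := SL2_group (p n)) (N := N) (N2 := N2) (L := 6))
  => // [t Vt|S symS genS A sAG A0 ltA||g Gg nZg].
- exact: SL2_nearly_redundant.
- exact: expander_card_le c0 cN (exp n S symS genS) sAG A0 ltA.
- exact: SL2_not_abelian.
- exact: cogen.
Qed.
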